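(* Let $f:\mathbb{R}^n\to\mathbb{R}$ and $g:\mathbb{R}^n\to\mathbb{R}^m$ be twice continuously differentiable, let $\Lambda\subseteq\mathbb{R}^m$ be closed, and let $\bar x$ be feasible for the problem (P): $\min f(x)$ s.t. $g(x)\in\Lambda$. Suppose that $d\in C(\bar x)$ satisfies $T^2_\Lambda(g(\bar x);\nabla g(\bar x)d)\ne\emptyset$ and the directional Robinson's constraint qualification in direction $d$: $$\nabla g(\bar x)^T\lambda=0,\ \lambda\in N^c_\Lambda(g(\bar x);\nabla g(\bar x)d)\ \Longrightarrow\ \lambda=0.$$ Then the following three statements are equivalent: (i) $\nabla f(\bar x)w+\nabla^2f(\bar x)(d,d)\ge0$ for all $w\in T^2_{\mathcal F}(\bar x;d)$. (ii) For every $u\in T^2_\Lambda(g(\bar x);\nabla g(\bar x)d)$ there exists $\lambda_u\in\Lambda^c(\bar x;d)$ such that $\nabla^2_{xx}L(\bar x,\lambda_u)(d,d)-\lambda_u^Tu\ge0$. (iii) For every nonempty convex subset $C\subseteq T^2_\Lambda(g(\bar x);\nabla g(\bar x)d)$ there exists $\lambda\in\Lambda^c(\bar x;d)$ such that $\nabla^2_{xx}L(\bar x,\lambda)(d,d)-\sigma_C(\lambda)\ge0$.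
   Context: $\mathcal F:=\{x: g(x)\in\Lambda\}$ is the feasible set. $\nabla g(x)\in\mathbb{R}^{m\times n}$ is the Jacobian, $\nabla f(x)$ is viewed as a row vector, and $\nabla^2f(\bar x)(d,d)=d^T\nabla^2f(\bar x)d$. The Lagrangian is $L(x,\lambda):=f(x)+g(x)^T\lambda$; $\nabla_xL$ is its gradient in $x$ and $\nabla^2_{xx}L(\bar x,\lambda)(d,d)=d^T\nabla^2_{xx}L(\bar x,\lambda)d$. For $x\in S$, $T_S(x):=\{d: \exists t_k\downarrow0,\ d_k\to d,\ x+t_kd_k\in S\}$; for $d\in T_S(x)$, $T^2_S(x;d):=\{w:\exists t_k\downarrow 0,\ w_k\to w,\ x+t_kd+\tfrac12t_k^2w_k\in S\}$. Critical cone: $C(\bar x):=\{d:\nabla g(\bar x)d\in T_\Lambda(g(\bar x)),\ \nabla f(\bar x)d\le0\}$. For $x\in S$, $\widehat N_S(x):=\{v:\langle v,x'-x\rangle\le o(\|x'-x\|)\ \forall x'\in S\}$ (empty if $x\notin S$). Directional limiting normal cone: $N_S(x;d):=\{v:\exists t_k\downarrow0,\ d_k\to d,\ v_k\to v,\ v_k\in\widehat N_S(x+t_kd_k)\}$. Directional Clarke normal cone: $N^c_S(x;d):=\mathrm{cl}\,\mathrm{co}\,N_S(x;d)$ (closed convex hull). Directional Clarke multiplier set: $\Lambda^c(\bar x;d):=\{\lambda:\nabla_xL(\bar x,\lambda)=0,\ \lambda\in N^c_\Lambda(g(\bar x);\nabla g(\bar x)d)\}$. Support function: $\sigma_C(\lambda):=\sup\{\lambda^Tu:u\in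 C\}$. *)

(* Defs.v *)
From HB Require Import structures.
From mathcomp Require Import all_boot all_order all_algebra.
From mathcomp Require Import all_classical all_reals all_analysis.

Set Implicit Arguments.
Unset Strict Implicit.
Unset Printing Implicit Defensive.

Import Order.TTheory GRing.Theory Num.Theory.
Import numFieldNormedType.Exports.

Local Open Scope classical_set_scope.
Local Open Scope ring_scope.

(** Vectors of R^n are row vectors ['rV[R]_n]. The library Jacobian ['J g x]
    acts on row vectors from the right, so it is the transpose of the usual
    m x n Jacobian matrix: the product of the Jacobian with d is
    [d *m 'J g x], and that of its transpose with l is [l *m ('J g x)^T].

    The norm on ['rV[R]_n] is the sup norm; the notions below depend only on
    the equivalence class of the norm. *)

Section Calculus.
Context {R : realType}.

Definition dot {n} (u v : 'rV[R]_n) : R := \sum_(i < n) u 0 i * v 0 i.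

Definition grad {n} (f : 'rV[R]_n -> R) (x : 'rV[R]_n) : 'rV[R]_n :=
  \row_(j < n) 'D_(delta_mx 0 j) f x.

Definition hess {n} (f : 'rV[R]_n -> R) (x : 'rV[R]_n) : 'M[R]_n :=
  'J (grad f) x.

Definition qform {n} (H : 'M[R]_n) (d : 'rV[R]_n) : R := dot (d *m H) d.

(** In finite dimension, continuity of the derivative in operator norm is
    continuity of its value at each fixed vector. *)
Definition C1 {V W : normedModType R} (f : V -> W) : Prop :=
  (forall x, differentiable f x) /\ (forall v, continuous (fun x => 'd f x v)).

Definition C2 {V W : normedModType R} (f : V -> W) : Prop :=
  (forall x, differentiable f x) /\ (forall v, C1 (fun x => 'd f x v)).

End Calculus.

Section VariationalGeometry.
Context {R : realType} {n : nat}.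
Implicit Types (S C : set 'rV[R]_n) (x d : 'rV[R]_n).

Definition decreases_to0 (t : R^nat) : Prop :=
  (forall k, 0 < t k) /\ t @ \oo --> (0 : R).

Definition tangent_cone S x : set 'rV[R]_n :=
  [set d | exists (t : R^nat) (d_ : ('rV[R]_n)^nat),
    [/\ decreases_to0 t, d_ @ \oo --> d & forall k, S (x + t k *: d_ k)]].

Definition second_order_tangent_set S x d : set 'rV[R]_n :=
  [set w | exists (t : R^nat) (w_ : ('rV[R]_n)^nat),
    [/\ decreases_to0 t, w_ @ \oo --> w &
        forall k, S (x + t k *: d + (2^-1 * t k ^+ 2) *: w_ k)]].

Definition regular_normal_cone S x : set 'rV[R]_n :=
  [set v | S x /\ forall e : R, 0 < e ->
    \forall x' \near x, S x' -> dot v (x' - x) <= e * `|x' - x|].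

Definition dir_normal_cone S x d : set 'rV[R]_n :=
  [set v | exists (t : R^nat) (d_ v_ : ('rV[R]_n)^nat),
    [/\ decreases_to0 t, d_ @ \oo --> d, v_ @ \oo --> v &
        forall k, regular_normal_cone S (x + t k *: d_ k) (v_ k)]].

Definition convex_hull S : set 'rV[R]_n := smallest (@convex_set R 'rV[R]_n) S.

Definition dir_clarke_normal_cone S x d : set 'rV[R]_n :=
  closure (convex_hull (dir_normal_cone S x d)).

Definition support_function C (l : 'rV[R]_n) : \bar R :=
  ereal_sup [set (dot l u)%:E | u in C].

End VariationalGeometry.

Section Problem.
Context {R : realType} {n m : nat}.
Variables (f : 'rV[R]_n -> R) (g : 'rV[R]_n -> 'rV[R]_m).
Variable (Lambda : set 'rV[R]_m).

Definition feasible_set : set 'rV[R]_n := [set x | Lambda (g x)].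

Definition lagrangian (l : 'rV[R]_m) (x : 'rV[R]_n) : R := f x + dot (g x) l.

Definition critical_cone (x : 'rV[R]_n) : set 'rV[R]_n :=
  [set d | tangent_cone Lambda (g x) (d *m 'J g x) /\ dot (grad f x) d <= 0].

Definition dir_clarke_multipliers (x d : 'rV[R]_n) : set 'rV[R]_m :=
  [set l | grad (lagrangian l) x = 0 /\
           dir_clarke_normal_cone Lambda (g x) (d *m 'J g x) l].

Definition dir_robinson_cq (x d : 'rV[R]_n) : Prop :=
  forall l : 'rV[R]_m, l *m ('J g x)^T = 0 ->
    dir_clarke_normal_cone Lambda (g x) (d *m 'J g x) l -> l = 0.

End Problem.

(* Main.v *)
Require Import Defs.
From HB Require Import structures.
From mathcomp Require Import all_boot all_order all_algebra.
From mathcomp Require Import all_classical all_reals all_analysis.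
From mathcomp Require Import ring lra.

Set Implicit Arguments.
Unset Strict Implicit.
Unset Printing Implicit Defensive.

Import Order.TTheory GRing.Theory Num.Theory.
Import numFieldNormedType.Exports.

Local Open Scope classical_set_scope.
Local Open Scope ring_scope.

(** Write y for g xbar, A for the Jacobian of g at xbar as it acts on row
    vectors, v for its value at d, b for the second derivative of g along d,
    N for the limiting normal cone of Lambda at y in direction v, and K for the
    polar cone of N. The second-order tangent set T2 of Lambda at y along v is
    neither convex nor a cone, but the following two facts make the equivalence
    a statement of linear conic duality.

    - T2 + K is contained in T2 ([second_order_tangent_polar]). Start from a
      point of Lambda on a second-order arc and walk along an element k of K.
      When the distance to Lambda increases, it does so at the rate of the inner
      product of k with a regular unit normal at a point close to the arc; such
      normals are close to N, so this rate is almost nonpositive.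

    - A vector w is a second-order tangent of the feasible set along d iff
      w A + b is in T2. One direction is a second-order Taylor expansion
      ([second_order_tangent_image]). The other
      ([second_order_tangent_preimage]) is metric subregularity in direction d:
      minimizing the distance from g x to Lambda plus a small multiple of the
      distance from x to the approximate solution yields a truly feasible point,
      since a nonzero residual would be a regular normal on which the adjoint of
      the Jacobian is small, and the constraint qualification excludes this.

    Now let C be a nonempty convex subset of T2. By the two facts, (i) gives
    <grad f, w> + D2f(d,d) >= 0 as soon as w A + b lies in C + K, which is a
    convex set. Separating the origin from the corresponding set of values in
    R^(m+1) produces a multiplier l and a nonnegative weight of the objective
    ([conic_duality]). The multiplier is polar to K, hence it lies in the closed
    convex hull of N by the bipolar theorem ([polar_polar]); a zero weight is
    excluded by the constraint qualification; and the remaining inequality is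
    (iii). Singletons C give (ii), and (ii) gives (i) by evaluating the
    inequality for u = w A + b, where stationarity of the Lagrangian turns
    <l, w A> into - <grad f, w>. *)

(** * Euclidean dot product, sup norm and projections *)
Lemma cvg_sumr (R : realType) (V : normedModType R) (T I : Type)
    (F : set_system T) {FF : Filter F} (r : seq I) (f : I -> T -> V) (l : I -> V) :
  (forall i, f i @ F --> l i) ->
  (fun x => \sum_(i <- r) f i x) @ F --> \sum_(i <- r) l i.
Proof.
move=> fl; elim: r => [|i r IH].
  by rewrite big_nil; under eq_fun do rewrite big_nil; exact: cvg_cst.
rewrite big_cons; under eq_fun do rewrite big_cons.
exact: cvgD.
Qed.

Lemma cvg_coord (R : realType) (n : nat) (T : Type) (F : set_system T)
    {FF : Filter F} (f : T -> 'rV[R]_n) (u : 'rV[R]_n) i :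
  f @ F --> u -> (fun x => f x 0 i) @ F --> u 0 i.
Proof.
move=> fu; apply: (@continuous_cvg T _ _ F FF f (fun w : 'rV[R]_n => w ord0 i) u _ fu).
exact: coord_continuous.
Qed.

Section Dot.
Context {R : realType} {n : nat}.
Implicit Types (u v w : 'rV[R]_n) (a : R).

Lemma dotC u v : dot u v = dot v u.
Proof. by apply: eq_bigr => i _; rewrite mulrC. Qed.

Lemma dotDl u v w : dot (u + v) w = dot u w + dot v w.
Proof. by rewrite /dot -big_split; apply: eq_bigr => i _; rewrite mxE mulrDl. Qed.

Lemma dotZl a u w : dot (a *: u) w = a * dot u w.
Proof. by rewrite /dot mulr_sumr; apply: eq_bigr => i _; rewrite mxE mulrA. Qed.

Lemma dotNl u w : dot (- u) w = - dot u w.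
Proof. by rewrite -scaleN1r dotZl mulN1r. Qed.

Lemma dotDr u v w : dot w (u + v) = dot w u + dot w v.
Proof. by rewrite dotC dotDl !(dotC w). Qed.

Lemma dotZr a u w : dot w (a *: u) = a * dot w u.
Proof. by rewrite dotC dotZl (dotC w). Qed.

Lemma dotNr u w : dot w (- u) = - dot w u.
Proof. by rewrite dotC dotNl (dotC w). Qed.

Lemma dotBr u v w : dot w (u - v) = dot w u - dot w v.
Proof. by rewrite dotDr dotNr. Qed.

Lemma dot0l u : dot 0 u = 0.
Proof. by rewrite -(scale0r 0) dotZl mul0r. Qed.

Lemma dot0r u : dot u 0 = 0.
Proof. by rewrite dotC dot0l. Qed.

Lemma dot_ge0 u : 0 <= dot u u.
Proof. by apply: sumr_ge0 => i _; rewrite -expr2 sqr_ge0. Qed.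

Lemma coord_le_norm u i : `|u 0 i| <= `|u|.
Proof.
by rewrite [leRHS]/Num.Def.normr/= mx_normrE; exact: (le_bigmax _ (fun k => `|u k.1 k.2|) (0, i)).
Qed.

Lemma norm_le_coord u a : 0 <= a -> (forall i, `|u 0 i| <= a) -> `|u| <= a.
Proof.
move=> a0 ua; rewrite [leLHS]/Num.Def.normr/= mx_normrE bigmax_le// => -[i j] _ /=.
by rewrite ord1.
Qed.

Lemma sqr_norm_le_dot u : `|u| ^+ 2 <= dot u u.
Proof.
rewrite -[leRHS]sqr_sqrtr ?dot_ge0// lerXn2r ?nnegrE ?sqrtr_ge0//.
apply: norm_le_coord => [|i]; first exact: sqrtr_ge0.
rewrite -sqrtr_sqr ler_sqrt ?dot_ge0// /dot (bigD1 i)//= -expr2 lerDl.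
by apply: sumr_ge0 => j _; rewrite -expr2 sqr_ge0.
Qed.

Lemma norm_le_dot u a : 0 <= a -> dot u u <= a ^+ 2 -> `|u| <= a.
Proof.
move=> a0 ua; rewrite -(@ler_pXn2r _ 2%N) ?nnegrE//.
exact: le_trans (sqr_norm_le_dot _) ua.
Qed.

Lemma norm_dot_le u v : `|dot u v| <= n%:R * (`|u| * `|v|).
Proof.
apply: (le_trans (ler_norm_sum _ _ _)).
have -> : n%:R * (`|u| * `|v|) = \sum_(i < n) (`|u| * `|v|).
  by rewrite sumr_const card_ord mulr_natl.
apply: ler_sum => i _.
by rewrite normrM ler_pM// coord_le_norm.
Qed.

Lemma dot_le u v : dot u v <= n%:R * (`|u| * `|v|).
Proof. exact: le_trans (ler_norm _) (norm_dot_le _ _). Qed.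

Lemma dot_eq0 u : dot u u = 0 -> u = 0.
Proof.
move=> u0; apply/eqP; rewrite -normr_eq0 -sqrf_eq0 eq_le sqr_ge0 andbT.
by rewrite -u0 sqr_norm_le_dot.
Qed.

Lemma dot_gt0 u : u != 0 -> 0 < dot u u.
Proof.
move=> u0; rewrite lt_neqAle dot_ge0 andbT eq_sym; apply: contra_neq u0.
exact: dot_eq0.
Qed.

Lemma dotDD u v : dot (u + v) (u + v) = dot u u + 2 * dot u v + dot v v.
Proof. by rewrite dotDl !dotDr (dotC v u); ring. Qed.

Lemma dotBB u v : dot (u - v) (u - v) = dot u u - 2 * dot u v + dot v v.
Proof. by rewrite dotDD dotNr dotNr dotNl opprK mulrN. Qed.

Lemma cvg_dot (T : Type) (F : set_system T) {FF : Filter F}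
    (f g : T -> 'rV[R]_n) u v :
  f @ F --> u -> g @ F --> v -> (fun x => dot (f x) (g x)) @ F --> dot u v.
Proof.
move=> fu gv; apply: (cvg_sumr (V := R)) => i; apply: cvgM.
  exact: cvg_coord fu.
exact: cvg_coord gv.
Qed.

End Dot.

Lemma dot_mulmx (R : realType) (n m : nat) (u : 'rV[R]_n) (M : 'M[R]_(n, m)) v :
  dot (u *m M) v = dot u (v *m M^T).
Proof.
rewrite /dot; under eq_bigr do rewrite mxE mulr_suml.
rewrite exchange_big; apply: eq_bigr => i _ /=.
by rewrite mxE mulr_sumr; apply: eq_bigr => j _; rewrite !mxE; ring.
Qed.

Lemma dot_row_mx (R : realType) (n m : nat) (a c : 'rV[R]_n) (b d : 'rV[R]_m) :
  dot (row_mx a b) (row_mx c d) = dot a c + dot b d.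
Proof.
rewrite /dot big_split_ord /=; congr (_ + _); apply: eq_bigr => i _.
  by rewrite !row_mxEl.
by rewrite !row_mxEr.
Qed.

Section Projection.
Context {R : realType} {n : nat}.
Implicit Types (S : set 'rV[R]_n) (x y z : 'rV[R]_n).

(** Only the sublevel set of the squared distance through [z0] matters, and it
    is compact. *)
Lemma closest_point S y z0 : closed S -> S z0 ->
  exists2 z, S z & forall z', S z' -> dot (y - z) (y - z) <= dot (y - z') (y - z').
Proof.
move=> clS Sz0.
pose q z := dot (y - z) (y - z).
have cq : continuous q.
  move=> z; have yz : (fun z : 'rV[R]_n => y - z) @ z --> y - z.
    by apply: (@continuousB R _ _ (cst y) id z); [exact: cst_continuous|exact: cvg_id].
  exact: (cvg_dot yz yz).
pose B := S `&` [set z | q z <= q z0].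
have cB : compact B.
  apply: bounded_closed_compact; last first.
    apply: closedI => //.
    by apply: (preimage_closed (D := [set r | r <= q z0])) => [? _|]; [exact: cq|exact: closed_le].
  exists (`|y| + Num.sqrt (q z0)); split => [|M hM z [_ /= hz]].
    by apply: num_real.
  apply: ltW; apply: le_lt_trans hM.
  rewrite -[z](subKr y) (le_trans (ler_normB _ _))// lerD2l.
  rewrite -[leLHS]ger0_norm// -sqrtr_sqr ler_wsqrtr//.
  exact: le_trans (sqr_norm_le_dot _) hz.
have [||z] := EVT_min_rV (A := B) (f := q) _ cB.
- by exists z0; split => /=.
- exact: continuous_subspaceT.
rewrite inE => -[Sz zz0] zmin; exists z => // z' Sz'.
have [z'z0|/ltW z'z0] := leP (q z') (q z0); last exact: le_trans zz0 z'z0.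
by apply: zmin; rewrite inE; split.
Qed.

Lemma convex_setP S : convex_set S <->
  (forall x y (t : R), 0 <= t -> t <= 1 -> S x -> S y -> S (t *: x + (1 - t) *: y)).
Proof.
split => [cS x y t t0 t1 Sx Sy|cS x y l].
  have := cS x y (Itv01 t0 t1); rewrite !inE => /(_ Sx Sy).
  by [].
by rewrite !inE => Sx Sy; apply: cS.
Qed.

(** Variational inequality of the projection: a positive value would let the
    squared distance decrease along the segment from [z] to [z']. *)
Lemma convex_closest_point S y z : convex_set S -> S z ->
  (forall z', S z' -> dot (y - z) (y - z) <= dot (y - z') (y - z')) ->
  forall z', S z' -> dot (y - z) (z' - z) <= 0.
Proof.
move=> /convex_setP cS Sz zmin z' Sz'; rewrite leNgt; apply/negP => a0.
set a := dot _ _ in a0; pose b := dot (z' - z) (z' - z).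
have b0 : 0 <= b := dot_ge0 _.
have ab0 : 0 < a + b by rewrite ltr_wpDr.
pose t := a / (a + b).
have t0 : 0 < t by rewrite divr_gt0.
have t1 : t <= 1 by rewrite ler_pdivrMr// mul1r lerDl.
have := zmin _ (cS z' z t (ltW t0) t1 Sz' Sz).
have -> : y - (t *: z' + (1 - t) *: z) = (y - z) - t *: (z' - z).
  by apply/matrixP => i j; rewrite !mxE; ring.
rewrite (dotBB (y - z)) !dotZr dotZl -/a -/b => h.
have : t * b < 2 * a.
  rewrite /t mulrAC ltr_pdivrMr//; nra.
move=> h2; have : t * (t * b) < t * (2 * a) by rewrite ltr_pM2l.
lra.
Qed.

End Projection.

(** * Separation and polarity in finite dimension *)
Lemma compact_sphere (R : realType) (n : nat) :
  compact [set p : 'rV[R]_n | `|p| = 1].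
Proof.
apply: bounded_closed_compact.
  by exists 1; split => [|M M1 p /= ->]; [exact: num_real|exact: ltW].
apply: (preimage_closed (f := @Num.norm R 'rV[R]_n) (D := [set r | r = 1])) => [a _|].
  exact: norm_continuous.
exact: closed_eq.
Qed.

Section Separation.
Context {R : realType} {n : nat}.
Implicit Types (S : set 'rV[R]_n) (x y z : 'rV[R]_n).

(** The pairs (y, s) such that y is s times a point of [S], with (0, 0) added,
    are stable under addition; this avoids dividing by partial sums of the
    coefficients that may vanish. *)
Lemma convex_combination S r (x : 'I_r -> 'rV[R]_n) (a : 'I_r -> R) :
  convex_set S -> (forall i, S (x i)) -> (forall i, 0 <= a i) ->
  \sum_i a i = 1 -> S (\sum_i a i *: x i).
Proof.
move=> /convex_setP cS Sx a0 a1.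
pose G (y : 'rV[R]_n) (s : R) := (s = 0 /\ y = 0) \/ (0 < s /\ S (s^-1 *: y)).
suff: G (\sum_i a i *: x i) (\sum_i a i).
  rewrite a1 => -[[/eqP]|]; first by rewrite oner_eq0.
  by rewrite invr1 scale1r => -[].
apply: (big_ind2 G) => [|y1 s1 y2 s2|i _]; first by left.
  move=> [[-> ->]|[s10 Sy1]] [[-> ->]|[s20 Sy2]]; rewrite ?add0r ?addr0.
  - by left.
  - by right.
  - by right.
  - right; split; first exact: addr_gt0.
    have s120 : 0 < s1 + s2 by exact: addr_gt0.
    have -> : (s1 + s2)^-1 *: (y1 + y2) =
        (s1 / (s1 + s2)) *: (s1^-1 *: y1) + (1 - s1 / (s1 + s2)) *: (s2^-1 *: y2).
      rewrite !scalerA scalerDr; congr (_ *: _ + _ *: _).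
        by rewrite mulrAC divff ?gt_eqF// mul1r.
      by field; rewrite !gt_eqF.
    apply: cS => //; first by rewrite divr_ge0 ?ltW.
    by rewrite ler_pdivrMr// mul1r lerDl ltW.
have := a0 i; rewrite le_eqVlt => /orP[/eqP <-|ai0]; first by left; rewrite scale0r.
by right; split => //; rewrite scalerA mulVf ?gt_eqF// scale1r.
Qed.

(** The polytope spanned by the points is compact and avoids the origin; its
    point of least norm is the required functional. *)
Lemma finite_separation S r (x : 'I_r.+1 -> 'rV[R]_n) :
  convex_set S -> ~ S 0 -> (forall i, S (x i)) ->
  exists2 p, p != 0 & forall i, 0 <= dot p (x i).
Proof.
move=> cS S0 Sx.
pose D : set 'rV[R]_r.+1 := [set a | (forall i, 0 <= a 0 i) /\ \sum_i a 0 i = 1].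
pose h (a : 'rV[R]_r.+1) := \sum_i a 0 i *: x i.
have cD : compact D.
  apply: bounded_closed_compact.
    exists 1; split => [|M M1 a [a0 a1]]; first exact: num_real.
    apply: norm_le_coord => [|i]; first by rewrite ltW// (lt_trans _ M1).
    rewrite ger0_norm// (le_trans _ (ltW M1))// -a1 (bigD1 i)//= lerDl.
    by apply: sumr_ge0 => j _; exact: a0.
  have -> : D = (\bigcap_(i in setT) [set a | 0 <= a 0 i]) `&` [set a | \sum_i a 0 i = 1].
    by rewrite predeqE => a; split => -[a0 a1]; split => // i; [move=> _|]; exact: a0.
  apply: closedI.
    apply: closed_bigI => i _.
    apply: (preimage_closed (f := fun a : 'rV[R]_r.+1 => a 0 i) (D := [set r | 0 <= r])) => [a _|].
      exact: coord_continuous.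
    exact: closed_ge.
  apply: (preimage_closed (f := fun a : 'rV[R]_r.+1 => \sum_i a 0 i) (D := [set r | r = 1])) => [a _|].
    by apply: (@cvg_sumr R R _ _ (nbhs a) _) => i; exact: coord_continuous.
  exact: closed_eq.
have cP : compact (h @` D).
  apply: continuous_compact => //; apply: continuous_subspaceT => a.
  apply: (@cvg_sumr R _ _ _ (nbhs a) _) => i; apply: cvgZr_tmp; exact: coord_continuous.
have cvP : convex_set (h @` D).
  apply/convex_setP => _ _ t t0 t1 [a [a0 a1] <-] [b [b0 b1] <-].
  exists (t *: a + (1 - t) *: b).
    split=> [i|]; first by rewrite !mxE addr_ge0// mulr_ge0// subr_ge0.
    under eq_bigr do rewrite !mxE.
    by rewrite big_split/= -!mulr_sumr a1 b1; ring.
  rewrite /h !scaler_sumr -big_split; apply: eq_bigr => i _ /=.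
  by rewrite !mxE [LHS]scalerDl !scalerA.
have Dx i : (h @` D) (x i).
  exists (delta_mx 0 i); last first.
    rewrite /h (bigD1 i)//= big1 => [|j ji]; first by rewrite !mxE !eqxx scale1r addr0.
    by rewrite !mxE (negPf ji) andbF scale0r.
  split=> [j|]; first by rewrite mxE; case: (_ && _).
  rewrite (bigD1 i)//= big1 => [|j ji]; first by rewrite !mxE !eqxx addr0.
  by rewrite !mxE (negPf ji) andbF.
have [p Pp pmin] := closest_point 0 (compact_closed (@norm_hausdorff _ _) cP) (Dx ord0).
exists p.
  apply/eqP => p0; apply: S0; rewrite -p0; case: Pp => a [a0 a1] <-.
  exact: convex_combination.
move=> i; have := convex_closest_point cvP Pp pmin (Dx i).
rewrite sub0r dotNl dotBr oppr_le0 subr_ge0; apply: le_trans; exact: dot_ge0.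
Qed.

(** [S] need not be closed, so projecting the origin is of no use. Each point of
    [S] defines a closed part of the unit sphere, finitely many of these parts
    meet by [finite_separation], and the sphere is compact. *)
Lemma weak_separation S x0 : convex_set S -> S x0 -> ~ S 0 ->
  exists2 p, p != 0 & forall x, S x -> 0 <= dot p x.
Proof.
move=> cS Sx0 S0.
pose sph : set 'rV[R]_n := [set p | `|p| = 1].
have := @compact_sphere R n; rewrite compact_In0.
move=> /(_ _ S (fun x => sph `&` [set p | 0 <= dot p x])) [||p Ip].
- exists (fun x => [set p | 0 <= dot p x]) => // x _.
  apply: (preimage_closed (f := dot ^~ x) (D := [set r | 0 <= r])) => [a _|].
    by apply: (@cvg_dot _ _ _ (nbhs a) _ id (cst x) a x); [exact: cvg_id|exact: cst_continuous].
  exact: closed_ge.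
- move=> D' D'S; pose s : seq 'rV[R]_n := finmap.enum_fset D'.
  have [|p p0 hp] := @finite_separation S (size s) (fun i => nth x0 (x0 :: s) i) cS S0.
    move=> i; have : nth x0 (x0 :: s) i \in x0 :: s by rewrite mem_nth.
    by rewrite inE => /orP[/eqP -> //|/D'S]; rewrite inE.
  have pn0 : 0 < `|p| by rewrite normr_gt0.
  exists (`|p|^-1 *: p) => x /= xD'; split.
    by rewrite /sph/= normrZ ger0_norm ?invr_ge0 ?ltW// mulVf ?gt_eqF.
  rewrite /= dotZl mulr_ge0 ?invr_ge0 ?(ltW pn0)//.
  have xin : x \in x0 :: s by rewrite inE [_ \in s]xD' orbT.
  have xs : (index x (x0 :: s) < (size s).+1)%N by rewrite (index_mem x (x0 :: s)).
  by have := hp (Ordinal xs); rewrite [nth _ _ _](nth_index x0 xin).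
have p1 : `|p| = 1 by have [] := Ip _ Sx0.
exists p => [|x Sx]; last by have [] := Ip _ Sx.
by rewrite -normr_eq0 p1 oner_eq0.
Qed.

Lemma closure_norm S x :
  closure S x <-> forall e : R, 0 < e -> exists2 y, S y & `|x - y| < e.
Proof.
split => [clx e e0|h B /nbhs_ballP[e /= e0 eB]].
  have [y [Sy xy]] := clx _ (nbhsx_ballx x e e0); exists y => //.
  by move: xy; rewrite -ball_normE.
by have [y Sy xy] := h _ e0; exists y; split => //; apply: eB; rewrite -ball_normE.
Qed.

Lemma convex_closure S : convex_set S -> convex_set (closure S).
Proof.
move=> /convex_setP cS; apply/convex_setP => x y t t0 t1 /closure_norm cx /closure_norm cy.
apply/closure_norm => e e0.
have [x' Sx' xx'] := cx _ e0; have [y' Sy' yy'] := cy _ e0.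
exists (t *: x' + (1 - t) *: y'); first exact: cS.
have -> : t *: x + (1 - t) *: y - (t *: x' + (1 - t) *: y') =
    t *: (x - x') + (1 - t) *: (y - y') by apply/matrixP => i j; rewrite !mxE; ring.
rewrite (le_lt_trans (ler_normD _ _))// !normrZ !ger0_norm ?subr_ge0//.
have [pq|/ltW pq] := leP `|x - x'| `|y - y'|; nra.
Qed.

Lemma convex_convex_hull S : convex_set (convex_hull S).
Proof.
apply/convex_setP => x y t t0 t1 hx hy C [cC SC].
by move/convex_setP: (cC); apply => //; [exact: hx|exact: hy].
Qed.

Definition polar S : set 'rV[R]_n := [set k | forall v, S v -> dot v k <= 0].

(** Bipolar theorem. If z is the projection of l, the cone property turns the
    variational inequality at z into the polarity of l - z, which forces
    l = z. *)
Lemma polar_polar S : S 0 -> (forall t v, 0 < t -> S v -> S (t *: v)) ->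
  polar (polar S) `<=` closure (convex_hull S).
Proof.
move=> S0 cS l hl.
set C := closure _; have cC : convex_set C by apply: convex_closure; exact: convex_convex_hull.
have SC : S `<=` C.
  by apply: subset_trans (@subset_closure _ _); exact: sub_gen_smallest.
have [z Cz zmin] := closest_point l (@closed_closure _ _) (SC _ S0).
have hz := convex_closest_point cC Cz zmin.
have kz : dot (l - z) z >= 0.
  by have := hz _ (SC _ S0); rewrite sub0r dotNr oppr_le0.
have Kk : polar S (l - z).
  move=> v Sv; rewrite dotC leNgt; apply/negP => kv.
  have t0 : 0 < (dot (l - z) z + 1) / dot (l - z) v by rewrite divr_gt0// ltr_wpDl.
  have := hz _ (SC _ (cS _ _ t0 Sv)).
  by rewrite dotBr dotZr divfK ?gt_eqF//; lra.
have lz : l - z = 0.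
  by apply: dot_eq0; apply/le_anti; rewrite dot_ge0 andbT dotBr; have := hl _ Kk; lra.
by move/eqP: lz; rewrite subr_eq0 => /eqP ->.
Qed.

End Separation.

(** * Directional normals and second-order tangents *)
Lemma near_invS_lt (R : realType) (e : R) :
  0 < e -> \forall k \near \oo, k.+1%:R^-1 < e.
Proof.
move=> e0; have /cvgrPdist_lt/(_ _ e0) := @cvg_harmonic R.
by apply: filterS => k; rewrite sub0r normrN ger0_norm /harmonic/= ?invr_ge0.
Qed.

Lemma cvg_seq_lt_invS (R : realType) (V : normedModType R) (u : nat -> V) (l : V) :
  (forall k, `|u k - l| < k.+1%:R^-1) -> u @ \oo --> l.
Proof.
move=> ul; apply/cvgrPdist_lt => e e0; apply: filterS (near_invS_lt e0) => k.
by apply: lt_trans; rewrite distrC.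
Qed.

Lemma near_dist_lt (R : realType) (V : normedModType R) (x : V) (e : R) :
  0 < e -> \forall y \near x, `|y - x| < e.
Proof.
by move=> e0; apply/nbhs_ballP; exists e => // y; rewrite -ball_normE /= distrC.
Qed.

Lemma near_distP (R : realType) (V : normedModType R) (x : V) (P : V -> Prop) :
  (\forall y \near x, P y) -> exists2 e : R, 0 < e & forall y, `|y - x| < e -> P y.
Proof.
move=> /nbhs_ballP[e /= e0 eP]; exists e => // y yx; apply: eP.
by rewrite -ball_normE /= distrC.
Qed.

Section VariationalGeometryLemmas.
Context {R : realType} {n : nat}.
Implicit Types (S : set 'rV[R]_n) (x d u w v p y z : 'rV[R]_n).

(** This form and the next one spare the extraction of subsequences. *)
Lemma second_order_tangentP S x d w :
  second_order_tangent_set S x d w <->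
  (forall e : R, 0 < e -> exists (t : R) w',
    [/\ 0 < t, t < e, `|w' - w| < e & S (x + t *: d + (2^-1 * t ^+ 2) *: w')]).
Proof.
split => [[t [w_ [[t0 tc] wc Sx]]] e e0|h].
  have : \forall k \near \oo, `|0 - t k| < e /\ `|w - w_ k| < e.
    by near=> k; split; near: k; [move/cvgrPdist_lt : tc|move/cvgrPdist_lt : wc]; exact.
  move=> [N _ hN]; have [tN wN] := hN N (leqnn N); exists (t N), (w_ N); split => //.
    by move: tN; rewrite sub0r normrN gtr0_norm.
  by rewrite distrC.
have h' k : exists tw : R * 'rV[R]_n, [/\ 0 < tw.1, tw.1 < k.+1%:R^-1,
    `|tw.2 - w| < k.+1%:R^-1 & S (x + tw.1 *: d + (2^-1 * tw.1 ^+ 2) *: tw.2)].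
  by have [//|t [w' h2]] := h k.+1%:R^-1; exists (t, w').
have [tw htw] := choice h'.
exists (fun k => (tw k).1), (fun k => (tw k).2); split.
- split=> [k|]; first by case: (htw k).
  apply: cvg_seq_lt_invS => k; case: (htw k) => t0 tk _ _.
  by rewrite subr0 gtr0_norm.
- by apply: cvg_seq_lt_invS => k; case: (htw k).
- by move=> k; case: (htw k).
Unshelve. all: by end_near.
Qed.

Lemma dir_normalP S x d v :
  dir_normal_cone S x d v <->
  (forall e : R, 0 < e -> exists (t : R) d' v',
    [/\ 0 < t, t < e, `|d' - d| < e, `|v' - v| < e &
        regular_normal_cone S (x + t *: d') v']).
Proof.
split => [[t [d_ [v_ [[t0 tc] dc vc Sx]]]] e e0|h].
  have : \forall k \near \oo, [/\ `|0 - t k| < e, `|d - d_ k| < e & `|v - v_ k| < e].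
    near=> k; split; near: k;
      [move/cvgrPdist_lt : tc|move/cvgrPdist_lt : dc|move/cvgrPdist_lt : vc]; exact.
  move=> [N _ hN]; have [tN dN vN] := hN N (leqnn N); exists (t N), (d_ N), (v_ N); split => //.
  - by move: tN; rewrite sub0r normrN gtr0_norm.
  - by rewrite distrC.
  - by rewrite distrC.
have h' k : exists tw : R * 'rV[R]_n * 'rV[R]_n, [/\ 0 < tw.1.1, tw.1.1 < k.+1%:R^-1,
    `|tw.1.2 - d| < k.+1%:R^-1, `|tw.2 - v| < k.+1%:R^-1 &
     regular_normal_cone S (x + tw.1.1 *: tw.1.2) tw.2].
  by have [//|t [d' [v' h2]]] := h k.+1%:R^-1; exists (t, d', v').
have [tw htw] := choice h'.
exists (fun k => (tw k).1.1), (fun k => (tw k).1.2), (fun k => (tw k).2); split.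
- split=> [k|]; first by case: (htw k).
  apply: cvg_seq_lt_invS => k; case: (htw k) => t0 tk _ _ _.
  by rewrite subr0 gtr0_norm.
- by apply: cvg_seq_lt_invS => k; case: (htw k).
- by apply: cvg_seq_lt_invS => k; case: (htw k).
- by move=> k; case: (htw k).
Unshelve. all: by end_near.
Qed.

Lemma regular_normalZ S x v (c : R) : 0 < c ->
  regular_normal_cone S x v -> regular_normal_cone S x (c *: v).
Proof.
move=> c0 [Sx hv]; split => // e e0.
have := hv (e / c); rewrite divr_gt0// => /(_ isT).
apply: filterS => x' h /h h'; rewrite dotZl.
have -> : e * `|x' - x| = c * (e / c * `|x' - x|) by rewrite mulrA mulrCA divff ?gt_eqF// mulr1.
by rewrite ler_pM2l.
Qed.

Lemma dir_normalZ S x d (c : R) v : 0 < c ->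
  dir_normal_cone S x d v -> dir_normal_cone S x d (c *: v).
Proof.
move=> c0 [t [d_ [v_ [t0 dc vc hS]]]]; exists t, d_, (fun k => c *: v_ k); split => //.
  by apply: cvgZl_tmp.
by move=> k; exact: regular_normalZ.
Qed.

Lemma dir_normal0 S x d : tangent_cone S x d -> dir_normal_cone S x d 0.
Proof.
move=> [t [d_ [t0 dc hS]]]; exists t, d_, (fun=> 0); split => //.
  exact: cvg_cst.
move=> k; split => // e e0; near=> x' => _; rewrite dot0l mulr_ge0//; exact: ltW.
Unshelve. all: by end_near.
Qed.

(** A closest point gives a proximal normal: expanding the squares bounds the
    inner product by half of the squared displacement. *)
Lemma projection_normal S y z : S z ->
  (\forall z' \near z, S z' -> dot (y - z) (y - z) <= dot (y - z') (y - z')) ->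
  regular_normal_cone S z (y - z).
Proof.
move=> Sz zmin; split => // e e0.
have e1 : 0 < e / (n%:R + 1) by rewrite divr_gt0// ltr_wpDl.
near=> z' => Sz'.
have : dot (y - z) (y - z) <= dot (y - z') (y - z') by move: Sz'; near: z'.
have -> : y - z' = (y - z) - (z' - z) by apply/matrixP => i j; rewrite !mxE; ring.
rewrite (dotBB (y - z)) => h.
have h2 := dot_le (z' - z) (z' - z).
have z'e : `|z' - z| <= e / (n%:R + 1).
  by apply/ltW; near: z'; exact: (@near_dist_lt R 'rV[R]_n z _ e1).
have {z'e} z'e : n%:R * `|z' - z| <= e.
  move: z'e; rewrite ler_pdivlMr ?ltr_wpDl// => z'e.
  apply: le_trans z'e; rewrite mulrC ler_wpM2l//.
  by rewrite lerDl.
have := ler_wpM2r (normr_ge0 (z' - z)) z'e.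
have := mulr_ge0 (ltW e0) (normr_ge0 (z' - z)).
rewrite mulrA in h2; lra.
Unshelve. all: by end_near.
Qed.

Lemma sphere_cluster (p : nat -> 'rV[R]_n) : (forall k, `|p k| = 1) ->
  exists2 q, `|q| = 1 &
    forall (e : R) N, 0 < e -> exists2 k, (N <= k)%N & `|p k - q| < e.
Proof.
move=> p1.
have [|q [q1 clq]] := @compact_sphere R n (p @ \oo) _; first by exists 0%N => // k _; exact: p1.
exists q => // e N e0.
have [_ [[k /= Nk <-] qk]] := clq (p @` [set k | (N <= k)%N]) (ball q e)
  (ltac:(by exists N => // k /= Nk; exists k)) (nbhsx_ballx q e e0).
by exists k => //; move: qk; rewrite -ball_normE /= distrC.
Qed.

(** Unit regular normals at points that approach [x] along [d] have their
    cluster points in the directional normal cone, so that a continuous function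
    that is positive on its unit vectors is bounded below by a positive constant
    on all of them sufficiently far along. *)
Lemma dir_normal_compactness S x d (q : 'rV[R]_n -> R) : continuous q ->
  (forall p, dir_normal_cone S x d p -> `|p| = 1 -> 0 < q p) ->
  exists2 e : R, 0 < e & forall (t : R) z r, 0 < t -> t < e ->
    `|z - (x + t *: d)| < e * t -> regular_normal_cone S z r -> r != 0 ->
    e <= q (`|r|^-1 *: r).
Proof.
move=> cq qpos; suff [e e0 he] : exists2 e : R, 0 < e & forall (t : R) d' p,
    0 < t -> t < e -> `|d' - d| < e ->
    regular_normal_cone S (x + t *: d') p -> `|p| = 1 -> e <= q p.
  exists e => // t z r t0 te zt hr r0.
  have rn0 : 0 < `|r| by rewrite normr_gt0.
  have := he t (t^-1 *: (z - x)) (`|r|^-1 *: r) t0 te.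
  have -> : x + t *: (t^-1 *: (z - x)) = z.
    by rewrite scalerA divff ?gt_eqF// scale1r addrC subrK.
  have -> : `|t^-1 *: (z - x) - d| = t^-1 * `|z - (x + t *: d)|.
    rewrite -[t^-1 in RHS]gtr0_norm ?invr_gt0// -normrZ; congr `| _ |.
    by rewrite opprD addrA [in RHS]scalerBr scalerA mulVf ?gt_eqF// scale1r.
  rewrite mulrC ltr_pdivrMr// normrZ gtr0_norm ?invr_gt0// mulVf ?gt_eqF//.
  apply=> //; by apply: regular_normalZ; rewrite ?invr_gt0.
apply: contrapT => noe.
have h k : exists tdp : R * 'rV[R]_n * 'rV[R]_n, [/\ 0 < tdp.1.1 < k.+1%:R^-1,
    `|tdp.1.2 - d| < k.+1%:R^-1, regular_normal_cone S (x + tdp.1.1 *: tdp.1.2) tdp.2,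
    `|tdp.2| = 1 & q tdp.2 < k.+1%:R^-1].
  apply: contrapT => no; apply: noe; exists k.+1%:R^-1 => // t d' p t0 te de hp p1.
  rewrite leNgt; apply/negP => qp; apply: no; exists (t, d', p); split => //=.
  by rewrite t0 te.
have [tdp htdp] := choice h.
have [|p p1 clp] := @sphere_cluster (fun k => (tdp k).2); first by move=> k; case: (htdp k).
have small (e : R) : 0 < e -> exists N, forall k, (N <= k)%N -> k.+1%:R^-1 < e.
  by move=> /near_invS_lt[N _ hN]; exists N.
have Np : dir_normal_cone S x d p.
  apply/dir_normalP => e e0; have [N hN] := small _ e0; have [k Nk pk] := clp _ N e0.
  have ke := hN _ Nk; case: (htdp k) => /andP[t0 tk] dk hk _ _.
  exists (tdp k).1.1, (tdp k).1.2, (tdp k).2; split => //; exact: lt_trans ke.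
have qp0 := qpos _ Np p1.
have q20 : 0 < q p / 2 by rewrite divr_gt0.
have /cvgrPdist_lt/(_ _ q20)/near_distP[r r0 hr] := cq p.
have [N hN] := small _ q20; have [k Nk /hr pk] := clp _ N r0.
have ke := hN _ Nk; case: (htdp k) => _ _ _ _ qk.
have {ke qk} qk := lt_trans qk ke.
by move: pk => /=; rewrite ltr_norml => /andP[_]; lra.
Qed.

End VariationalGeometryLemmas.

(** * Translating second-order tangents by polar vectors *)
Section T2.
Context {R : realType} {n : nat}.
Implicit Types (S : set 'rV[R]_n) (x d u w v p y z : 'rV[R]_n).

(** On the directional normal cone the inner product with [k] is nonpositive; for
    regular normals at nearby points it is at most a small multiple of their
    norm. *)
Lemma regular_normal_bound S x d k (eta : R) : 0 < eta ->
  polar (dir_normal_cone S x d) k ->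
  exists2 e : R, 0 < e & forall (t : R) z r, 0 < t -> t < e ->
    `|z - (x + t *: d)| < e * t -> regular_normal_cone S z r ->
    dot r k <= eta * `|r|.
Proof.
move=> eta0 Kk.
have cq : continuous (fun p : 'rV[R]_n => eta - dot p k).
  move=> p; apply: (@continuousB R _ _ (cst eta) (dot ^~ k) p); first exact: cst_continuous.
  by apply: (@cvg_dot _ _ _ (nbhs p) _ id (cst k) p k); [exact: cvg_id|exact: cst_continuous].
have [p /Kk pk _|e e0 he] := @dir_normal_compactness _ _ S x d _ cq; first by rewrite subr_gt0 (le_lt_trans pk).
exists e => // t z r t0 te zt hr.
have [->|r0] := eqVneq r 0; first by rewrite dot0l normr0 mulr0.
have rn0 : 0 < `|r| by rewrite normr_gt0.
have : dot (`|r|^-1 *: r) k <= eta by have := he t z r t0 te zt hr r0; lra.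
by rewrite dotZl mulrC ler_pdivrMr.
Qed.

(** Expansion of the squared distance around the projection [z'] of the point
    with parameter [s]: the first-order term is the inner product of [k] with a
    regular normal. As [y0] is in [S], the norm of this normal is at most [s]
    times that of [k]. *)
Lemma projection_step S y0 k (s h eta : R) z : closed S -> S y0 -> S z -> 0 <= s -> 0 <= h ->
  (forall z, S z -> dot (y0 + s *: k - z) (y0 + s *: k - z) <= s ^+ 2 * dot k k ->
     regular_normal_cone S z (y0 + s *: k - z) ->
     dot (y0 + s *: k - z) k <= eta * `|y0 + s *: k - z|) ->
  0 <= eta ->
  exists2 z', S z' & dot (y0 + (s + h) *: k - z') (y0 + (s + h) *: k - z') <=
    dot (y0 + s *: k - z) (y0 + s *: k - z) + 2 * h * eta * (s * Num.sqrt (dot k k))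
     + h ^+ 2 * dot k k.
Proof.
move=> clS Sy0 Sz s0 h0 hr eta0.
have [z' Sz' zmin] := closest_point (y0 + s *: k) clS Sz.
exists z' => //.
have rs := zmin _ Sy0; rewrite [y0 + _ - y0]addrAC subrr add0r dotZl dotZr mulrA -expr2 in rs.
have Nr : regular_normal_cone S z' (y0 + s *: k - z').
  by apply: projection_normal => //; near=> z'' => /zmin.
have hk := hr _ Sz' rs Nr.
have -> : y0 + (s + h) *: k - z' = (y0 + s *: k - z') + h *: k.
  by apply/matrixP => i j; rewrite !mxE; ring.
have rk : `|y0 + s *: k - z'| <= s * Num.sqrt (dot k k).
  apply: norm_le_dot; first by rewrite mulr_ge0// sqrtr_ge0.
  by rewrite exprMn sqr_sqrtr ?dot_ge0.
rewrite dotDD dotZr dotZl dotZr; have D := zmin _ Sz.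
have {}hk : h * dot (y0 + s *: k - z') k <= h * (eta * (s * Num.sqrt (dot k k))).
  by rewrite ler_wpM2l// (le_trans hk)// ler_wpM2l.
lra.
Unshelve. all: by end_near.
Qed.

(** The segment of direction [k] and length s1 = t^2 / 2 that starts on the arc
    is cut into [N] steps. The increments of the squared distance given by
    [projection_step] add up to s1^2 (2 eta |k| + |k|^2 / N), which is a small
    multiple of s1^2 when eta is small and [N] is large. *)
Lemma second_order_tangent_polar S x d u k : closed S ->
  second_order_tangent_set S x d u -> polar (dir_normal_cone S x d) k ->
  second_order_tangent_set S x d (u + k).
Proof.
move=> clS /second_order_tangentP Tu Kk; apply/second_order_tangentP => e e0.
pose kap : R := Num.sqrt (dot k k).
have kap0 : 0 <= kap := sqrtr_ge0 _.
have kap2 : kap ^+ 2 = dot k k by rewrite sqr_sqrtr// dot_ge0.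
(* With this eta, and with the number of steps below, each of the two terms of
   the final bound is at most e^2 / 8. *)
pose eta : R := e ^+ 2 / (16 * (kap + 1)).
have eta0 : 0 < eta by rewrite divr_gt0 ?exprn_gt0// mulr_gt0// ltr_wpDl.
have [dl dl0 hdl] := @regular_normal_bound S x d k eta eta0 Kk.
(* The projections stay within s1 * B of x + t d. *)
pose B := `|u| + 1 + `|k| + kap.
have B1 : 1 <= B by rewrite /B; have := normr_ge0 u; have := normr_ge0 k; lra.
have B0 : 0 < B by apply: lt_le_trans B1.
pose e1 : R := Num.min (Num.min 1 (e / 2)) (Num.min e (dl / B)).
have e10 : 0 < e1 by rewrite !lt_min ltr01 e0 !divr_gt0.
have [t [u' [t0 te1 uu' Sy]]] := Tu _ e10.
move: te1 uu'; rewrite !lt_min => /and3P[/andP[_ _] te tB] /andP[/andP[u1 ue] _].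
have [s1 s1E] : exists s1 : R, s1 = 2^-1 * t ^+ 2 by eexists.
have s10 : 0 < s1 by rewrite s1E mulr_gt0 ?invr_gt0 ?exprn_gt0.
rewrite -s1E in Sy; set y0 := x + _ + _ in Sy.
have tdl : t < dl by rewrite (lt_le_trans tB)// ler_pdivrMr// ler_peMr// ltW.
have step (s : R) z : 0 <= s -> s <= s1 -> S z ->
    dot (y0 + s *: k - z) (y0 + s *: k - z) <= s ^+ 2 * dot k k ->
    regular_normal_cone S z (y0 + s *: k - z) ->
    dot (y0 + s *: k - z) k <= eta * `|y0 + s *: k - z|.
  move=> s0 ss1 Sz hz; apply: (hdl t) => //.
  set r := y0 + s *: k - z in hz.
  have rk : `|r| <= s * kap.
    by apply: norm_le_dot; rewrite ?mulr_ge0// exprMn kap2.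
  have -> : z - (x + t *: d) = s1 *: u' + s *: k - r.
    by apply/matrixP => i j; rewrite /r /y0 !mxE; ring.
  apply: (@le_lt_trans _ _ (s1 * B)).
    rewrite (le_trans (ler_normB _ _))// (le_trans (lerD (ler_normD _ _) rk))//.
    rewrite !normrZ (gtr0_norm s10) (ger0_norm s0).
    have u'u : `|u'| <= `|u| + 1.
      by rewrite -(subrK u u') addrC (le_trans (ler_normD _ _))// lerD2l ltW.
    have h1 := ler_wpM2l (ltW s10) u'u.
    have h2 := ler_wpM2r (normr_ge0 k) ss1; have h3 := ler_wpM2r kap0 ss1.
    rewrite /B; lra.
  have {}tB : t * B < dl by rewrite -ltr_pdivlMr.
  have : t * (t * B) < t * dl by rewrite ltr_pM2l.
  have : 0 < t * (t * B) by rewrite !mulr_gt0.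
  rewrite s1E; lra.
pose N := (Num.truncn (8 * kap ^+ 2 / e ^+ 2)).+1.
have N0 : 0 < N%:R :> R by rewrite ltr0n.
pose h : R := s1 / N%:R.
have h0 : 0 < h by rewrite divr_gt0.
pose inc : R := 2 * h * eta * (s1 * kap) + h ^+ 2 * dot k k.
have walk j : (j <= N)%N -> exists2 z, S z &
    dot (y0 + (j%:R * h) *: k - z) (y0 + (j%:R * h) *: k - z) <= j%:R * inc.
  elim: j => [_|j IH jN].
    by exists y0 => //; rewrite !mul0r scale0r addr0 subrr dot0l.
  have [z Sz hz] := IH (ltnW jN).
  have s0 : 0 <= j%:R * h by rewrite mulr_ge0// ltW.
  have ss1 : j%:R * h <= s1.
    rewrite /h mulrCA ler_piMr ?(ltW s10)// ler_pdivrMr// mul1r ler_nat.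
    exact: ltnW.
  have [z' Sz' hz'] := @projection_step S y0 k (j%:R * h) h eta z clS Sy Sz s0 (ltW h0)
     (fun z => @step _ z s0 ss1) (ltW eta0).
  exists z' => //; rewrite -natr1 [(_ + 1) * h]mulrDl mul1r.
  apply: (le_trans hz'); rewrite -/kap.
  have : h * eta * (j%:R * h * kap) <= h * eta * (s1 * kap).
    by rewrite (ler_pM2l (mulr_gt0 h0 eta0)) ler_wpM2r.
  by move: hz; rewrite /inc; lra.
have [z Sz] := walk N (leqnn N).
have -> : N%:R * h = s1 by rewrite mulrC divfK// gt_eqF.
have -> : N%:R * inc = s1 ^+ 2 * (2 * eta * kap + kap ^+ 2 / N%:R).
  by rewrite /inc -kap2 /h; field; rewrite gt_eqF.
set r := y0 + s1 *: k - z => hr.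
have r_small : `|r| <= s1 * (e / 2).
  apply: norm_le_dot; first by rewrite mulr_ge0 ?divr_ge0// ltW.
  apply: (le_trans hr).
  rewrite exprMn ler_wpM2l ?sqr_ge0//.
  have h1 : 2 * eta * kap <= e ^+ 2 / 8.
    rewrite /eta. 
    have -> : 2 * (e ^+ 2 / (16 * (kap + 1))) * kap = e ^+ 2 / 8 * (kap / (kap + 1)).
      by field; rewrite gt_eqF// ltr_wpDl.
    rewrite ler_piMr ?divr_ge0 ?sqr_ge0// ler_pdivrMr ?ltr_wpDl// mul1r lerDl//.
  have h2 : kap ^+ 2 / N%:R <= e ^+ 2 / 8.
    rewrite ler_pdivrMr// -ler_pdivrMl ?divr_gt0 ?exprn_gt0//.
    have -> : (e ^+ 2 / 8)^-1 * kap ^+ 2 = 8 * kap ^+ 2 / e ^+ 2.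
      by field; rewrite gt_eqF.
    apply: ltW; rewrite /N; apply: truncnS_gt.
  lra.
exists t, (u' + k - s1^-1 *: r); split => //.
  have -> : u' + k - s1^-1 *: r - (u + k) = (u' - u) - s1^-1 *: r.
    by apply/matrixP => i j; rewrite !mxE; ring.
  rewrite (le_lt_trans (ler_normB _ _))// normrZ gtr0_norm ?invr_gt0//.
  have : s1^-1 * `|r| <= e / 2 by rewrite ler_pdivrMl.
  lra.
rewrite -s1E.
have -> : x + t *: d + s1 *: (u' + k - s1^-1 *: r) = z.
  rewrite scalerBr scalerA divff ?gt_eqF// scale1r.
  by apply/matrixP => i j; rewrite /r /y0 !mxE; ring.
by [].
Qed.

End T2.

(** * Second-order Taylor expansions *)
Section Calc.
Context {R : realType} {n : nat}.
Implicit Types (x d e w : 'rV[R]_n).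

Lemma linear_sub_bound (W : normedModType R) (a b : {linear 'rV[R]_n -> W}) (eta : R) e :
  (forall j, `|a (delta_mx 0 j) - b (delta_mx 0 j)| <= eta) ->
  `|a e - b e| <= n%:R * (eta * `|e|).
Proof.
move=> hab; rewrite {1 2}[e]row_sum_delta (linear_sum a) (linear_sum b) -sumrB (le_trans (ler_norm_sum _ _ _))//.
apply: (@le_trans _ _ (\sum_(j < n) eta * `|e|)); last by rewrite sumr_const card_ord mulr_natl.
by apply: ler_sum => j _; rewrite [a _]linearZ [b _]linearZ -scalerBr normrZ mulrC ler_pM// coord_le_norm.
Qed.

(** Continuity of the derivative at each basis vector is continuity in operator
    norm. *)
Lemma C1_near (W : normedModType R) (g : 'rV[R]_n -> W) x (eps : R) :
  C1 g -> 0 < eps -> \forall y \near x, forall e, `|'d g y e - 'd g x e| <= eps * `|e|.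
Proof.
move=> [_ cg] eps0.
have eps1 : 0 < eps / (n%:R + 1) by rewrite divr_gt0// ltr_wpDl.
near=> y => e.
have hy j : `|'d g y (delta_mx 0 j) - 'd g x (delta_mx 0 j)| <= eps / (n%:R + 1).
  move: j; near: y; apply: filter_forall => j.
  have /cvgrPdist_le/(_ _ eps1) := cg (delta_mx 0 j) x.
  by apply: filterS => y hy; rewrite -normrN opprB; exact: hy.
have := linear_sub_bound e hy.
have -> : eps * `|e| = (n%:R + 1) * (eps / (n%:R + 1) * `|e|).
  by field; rewrite gt_eqF// ltr_wpDl.
move=> /le_trans; apply; rewrite ler_wpM2r// ?lerDl//.
by rewrite mulr_ge0// ltW.
Unshelve. all: by end_near.
Qed.

Lemma is_derive_line (W : normedModType R) (f : 'rV[R]_n -> W) x d (s : R) :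
  differentiable f (x + s *: d) ->
  is_derive s 1 (fun s => f (x + s *: d)) ('d f (x + s *: d) d).
Proof.
move=> df.
have E : (fun h : R => h^-1 *: (f (x + (h *: 1 + s) *: d) - f (x + s *: d))) =
         (fun h : R => h^-1 *: (f (h *: d + (x + s *: d)) - f (x + s *: d))).
  apply/funext => h; congr (_ *: (f _ - _)).
  by rewrite scalerDl addrCA [h *: 1]mulr1.
split; first by rewrite /derivable E; exact: diff_derivable.
by rewrite -deriveE// /derive E.
Qed.

Lemma mean_value_line (f : 'rV[R]_n -> R) x d (t : R) : 0 < t ->
  (forall y, differentiable f y) ->
  exists2 c : R, 0 < c < t & f (x + t *: d) - f x = t * 'd f (x + c *: d) d.
Proof.
move=> t0 df.
have dl (s : R) := is_derive_line (df (x + s *: d)).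
have [c|c] := @MVT _ (fun s => f (x + s *: d)) _ _ _ t0 (fun s _ => dl s).
  by move: c; apply: derivable_within_continuous => c _; exact: @ex_derive _ _ _ _ _ _ _ (dl c).
rewrite in_itv => c0 E; exists c => //.
by move: E; rewrite scale0r addr0 subr0 mulrC.
Qed.

Lemma derive_bound (W : normedModType R) (f : 'rV[R]_n -> W) x d (eps : R) :
  differentiable f x -> 0 < eps ->
  exists2 dl : R, 0 < dl & forall c : R, 0 < c -> c < dl ->
    `|f (x + c *: d) - f x - c *: 'd f x d| <= eps * c.
Proof.
move=> df eps0.
have := @diff_derivable _ _ _ f x d df; rewrite /derivable => /cvg_ex[l hl].
have E : 'd f x d = l by rewrite -deriveE// /derive; exact: cvg_lim.
move/cvgrPdist_le : hl => /(_ _ eps0); rewrite E => -[dl /= dl0 hdl].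
exists dl => // c c0 cdl.
have := hdl c; rewrite /ball_ /= sub0r normrN gtr0_norm// gt_eqF// => /(_ cdl isT).
rewrite [c *: d + x]addrC => h.
have -> : f (x + c *: d) - f x - c *: l = - (c *: (l - c^-1 *: (f (x + c *: d) - f x))).
  by rewrite scalerBr scalerA divff ?gt_eqF// scale1r opprB.
by rewrite normrN normrZ gtr0_norm// mulrC ler_wpM2r// ltW.
Qed.

Lemma is_derive_quadratic (a b s : R) :
  is_derive s 1 (fun s : R => s * a + 2^-1 * s ^+ 2 * b) (a + s * b).
Proof.
have dX : is_derive s 1 ((@id R) ^+ 2) (2 * s ^+ 1 *: 1).
  by apply: is_deriveX; exact: is_derive_id.
have dQ := is_deriveD (is_deriveZ a (is_derive_id s 1)) (is_deriveZ (2^-1 * b) dX).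
rewrite [X in is_derive _ _ X _](_ : _ = a *: (@id R) + (2^-1 * b) *: ((@id R) ^+ 2)).
  rewrite (_ : a + s * b = a *: 1 + (2^-1 * b) *: (2 * s ^+ 1 *: 1)) //.
  by rewrite -[RHS]/(a * 1 + 2^-1 * b * (2 * s ^+ 1 * 1)); field.
apply/funext => z; rewrite -[RHS]/(a * z + 2^-1 * b * (z * z)); ring.
Qed.

(** The derivatives are given as the parameters [dh1] and [b] so that they can be
    instantiated by coordinates of the derivatives of a vector-valued map. *)
Lemma second_order_expansion (h : 'rV[R]_n -> R) x d (M eps : R)
    (dh1 : 'rV[R]_n -> R) (b : R) : C2 h -> 0 < eps ->
  (forall w, dh1 w = 'd h x w) -> b = 'd (fun y => 'd h y d) x d ->
  exists2 dl : R, 0 < dl & forall (t : R) w, 0 < t -> t < dl -> `|w| <= M ->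
   `|h (x + t *: d + (2^-1 * t ^+ 2) *: w) - h x - t * dh1 d
     - 2^-1 * t ^+ 2 * (dh1 w + b)| <= eps * t ^+ 2.
Proof.
move=> [dh C1h] eps0 dh1E bE.
have M1 : 0 < `|M| + 1 by rewrite ltr_wpDl.
have eps2 : 0 < eps / 2 by rewrite divr_gt0.
have epsM : 0 < eps / (`|M| + 1) by rewrite divr_gt0.
have C1h' : C1 h by split => // v; have [_ _] := C1h v; move=> z; apply: differentiable_continuous; case: (C1h v).
have [r r0 hr] := near_distP (C1_near x C1h' epsM).
have [dl dl0 hdl] : exists2 dl : R, 0 < dl & forall c : R, 0 < c -> c < dl ->
    `|'d h (x + c *: d) d - 'd h x d - c * b| <= eps / 2 * c.
  rewrite bE; exact: (@derive_bound R (fun y => 'd h y d) x d (eps / 2) ((C1h d).1 x) eps2).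
exists (Num.min (Num.min 1 dl) (r / (`|d| + `|M| + 1))).
  by rewrite !lt_min ltr01 dl0 divr_gt0// -addrA ltr_wpDl.
move=> t w t0; rewrite !dh1E !lt_min => /andP[/andP[t1 tdl] tr] wM.
have {}tr : t * (`|d| + `|M| + 1) < r by rewrite -ltr_pdivlMr// -addrA ltr_wpDl.
have wM' : `|w| <= `|M| by rewrite (le_trans wM)// ler_norm.
pose s : R := 2^-1 * t ^+ 2.
have s0 : 0 < s by rewrite mulr_gt0 ?invr_gt0 ?exprn_gt0.
have first : `|h (x + t *: d) - h x - t * 'd h x d - s * b| <= eps / 2 * t ^+ 2.
  (* The mean value theorem for the second-order remainder along the line
     reduces the claim to the first-order expansion of the derivative. *)
  pose F := (fun s : R => h (x + s *: d)) - (fun s : R => s * 'd h x d + 2^-1 * s ^+ 2 * b).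
  have dF (c : R) : is_derive c 1 F ('d h (x + c *: d) d - ('d h x d + c * b)).
    by apply: is_deriveB; [exact: is_derive_line|exact: is_derive_quadratic].
  have [c|c] := @MVT _ F _ _ _ t0 (fun c _ => dF c).
    by move: c; apply: derivable_within_continuous => c _; exact: @ex_derive _ _ _ _ _ _ _ (dF c).
  rewrite in_itv => /andP[c0 ct] E.
  have -> : h (x + t *: d) - h x - t * 'd h x d - s * b = F t - F 0.
    by rewrite /F /s !fctE scale0r addr0; ring.
  rewrite E subr0 normrM (gtr0_norm t0).
  have hc := hdl c c0 (lt_trans ct tdl).
  rewrite opprD addrA expr2 mulrA ler_pM2r//.
  apply: (le_trans hc); rewrite ler_pM2l//; exact: ltW.
have second : `|h (x + t *: d + s *: w) - h (x + t *: d) - s * 'd h x w| <= s * eps.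
  have [c /andP[c0 cs] ->] := mean_value_line (x + t *: d) w s0 dh.
  rewrite -mulrBr normrM gtr0_norm// ler_pM2l//.
  have st : s <= t by rewrite /s expr2; nra.
  have yr : `|x + t *: d + c *: w - x| < r.
    have -> : x + t *: d + c *: w - x = t *: d + c *: w.
      by apply/matrixP => i j; rewrite !mxE; ring.
    rewrite (le_lt_trans (ler_normD _ _))// !normrZ.
    rewrite (gtr0_norm t0) (gtr0_norm c0); apply: le_lt_trans tr.
    have h1 := ler_wpM2l (ltW c0) wM'.
    have h2 := ler_wpM2r (normr_ge0 M) (le_trans (ltW cs) st).
    lra.
  apply: (le_trans (hr _ yr w)).
  rewrite mulrAC ler_pdivrMr// ler_pM2l//; lra.
have -> : h (x + t *: d + s *: w) - h x - t * 'd h x d - s * ('d h x w + b) =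
  (h (x + t *: d) - h x - t * 'd h x d - s * b) +
  (h (x + t *: d + s *: w) - h (x + t *: d) - s * 'd h x w) by ring.
apply: (le_trans (ler_normD _ _)); apply: (le_trans (lerD first second)).
rewrite /s; lra.
Qed.

End Calc.

Lemma dot_delta (R : realType) (n : nat) (u : 'rV[R]_n) j : dot u (delta_mx 0 j) = u 0 j.
Proof.
rewrite /dot (bigD1 j)//= big1 => [|i ij]; first by rewrite mxE !eqxx mulr1 addr0.
by rewrite mxE (negPf ij) andbF mulr0.
Qed.

Section DotRight.
Context {R : realType} {n : nat}.
Variable l : 'rV[R]_n.

(** Introduced to carry a linear structure. *)
Definition dot_right (u : 'rV[R]_n) : R := dot u l.

Lemma dot_right_is_linear : linear dot_right.
Proof. by move=> a u v; rewrite /dot_right dotDl dotZl. Qed.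

HB.instance Definition _ := GRing.isLinear.Build R 'rV[R]_n R _ dot_right dot_right_is_linear.

Lemma continuous_dot_right : continuous dot_right.
Proof.
move=> u; apply: (@cvg_dot _ _ _ (nbhs u) _ id (cst l) u l); first exact: cvg_id.
exact: cst_continuous.
Qed.

Lemma differentiable_dotr (V : normedModType R) (g : V -> 'rV[R]_n) x :
  differentiable g x -> differentiable (fun y => dot (g y) l) x.
Proof.
move=> dg; apply: (@differentiable_comp _ _ _ _ g dot_right) => //.
by apply: linear_differentiable; exact: continuous_dot_right.
Qed.

Lemma diff_dotr (V : normedModType R) (g : V -> 'rV[R]_n) x v :
  differentiable g x -> 'd (fun y => dot (g y) l) x v = dot ('d g x v) l.
Proof.
move=> dg.
have dl : differentiable dot_right (g x).
  by apply: linear_differentiable; exact: continuous_dot_right.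
have /(congr1 (fun h => h v)) := @diff_comp _ _ _ _ g dot_right x dg dl.
by rewrite (diff_lin _ continuous_dot_right).
Qed.

Lemma C2_dotr (V : normedModType R) (g : V -> 'rV[R]_n) :
  C2 g -> C2 (fun y => dot (g y) l).
Proof.
move=> [dg C1g]; split => [y|v]; first exact: differentiable_dotr.
have E : (fun x => 'd (fun y => dot (g y) l) x v) = (fun x => dot ('d g x v) l).
  by apply/funext => y; exact: diff_dotr.
have [d2 c2] := C1g v.
rewrite E; split => [y|w]; first exact: differentiable_dotr.
have -> : (fun x => 'd (fun y => dot ('d g y v) l) x w) =
          (fun x => dot ('d (fun y => 'd g y v) x w) l).
  by apply/funext => y; exact: diff_dotr.
move=> y; apply: (@cvg_dot _ _ _ (nbhs y) _ _ (cst l)); first exact: c2.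
exact: cst_continuous.
Qed.
End DotRight.

Lemma second_order_remainder_coord (R : realType) (m : nat)
    (p q a b c : 'rV[R]_m) (t s : R) j :
  (p - (q + t *: a + s *: (b + c))) 0 j =
  p 0 j - q 0 j - t * a 0 j - s * (b 0 j + c 0 j).
Proof. by rewrite !mxE; ring. Qed.

Section C2Lemmas.
Context {R : realType} {n m : nat}.
Implicit Types (f : 'rV[R]_n -> R) (g : 'rV[R]_n -> 'rV[R]_m) (x d v : 'rV[R]_n).

Lemma diffD_app (V W : normedModType R) (f g : V -> W) (x v : V) :
  differentiable f x -> differentiable g x ->
  'd (fun y => f y + g y) x v = 'd f x v + 'd g x v.
Proof.
by move=> df dg; have /(congr1 (fun h => h v)) := diffD df dg.
Qed.

Lemma C2D (V W : normedModType R) (f g : V -> W) :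
  C2 f -> C2 g -> C2 (fun y => f y + g y).
Proof.
move=> [df C1f] [dg C1g]; split => [y|v]; first exact: differentiableD.
have -> : (fun z => 'd (fun y => f y + g y) z v) = (fun z => 'd f z v + 'd g z v).
  by apply/funext => y; exact: diffD_app.
have [d2f c2f] := C1f v; have [d2g c2g] := C1g v.
split => [y|w]; first exact: differentiableD.
have -> : (fun z => 'd (fun y => 'd f y v + 'd g y v) z w) =
          (fun z => 'd (fun y => 'd f y v) z w + 'd (fun y => 'd g y v) z w).
  by apply/funext => y; exact: (@diffD_app _ _ (fun y => 'd f y v) (fun y => 'd g y v)).
move=> y; apply: cvgD; [exact: c2f|exact: c2g].
Qed.

Lemma dot_grad f x v : differentiable f x -> dot (grad f x) v = 'd f x v.
Proof.
move=> df; rewrite {2}[v]row_sum_delta linear_sum; apply: eq_bigr => j _.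
by rewrite mxE deriveE// linearZ mulrC.
Qed.

(** The Hessian matrix is the Jacobian of the gradient, hence the coordinates of
    the gradient have to be reassembled into the derivative along [d]. *)
Lemma qform_hess f x d : C2 f -> qform (hess f x) d = 'd (fun y => 'd f y d) x d.
Proof.
move=> [df C1f].
have dgf : differentiable (grad f) x.
  have -> : grad f = \sum_(j < n) (fun y => 'd f y (delta_mx 0 j) *: (delta_mx 0 j : 'rV[R]_n)).
    apply/funext => y; rewrite fct_sumE [LHS]row_sum_delta; apply: eq_bigr => j _.
    by rewrite mxE deriveE.
  apply: differentiable_sum => j; apply: differentiableZl; exact: (C1f _).1.
rewrite /qform /hess -deriveEjacobian// deriveE// -diff_dotr//.
congr ('d _ x d); apply/funext => y; exact: dot_grad.
Qed.

Lemma second_order_expansion_vec g x d (M eps : R) : C2 g -> 0 < eps ->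
  exists2 dl : R, 0 < dl & forall (t : R) w, 0 < t -> t < dl -> `|w| <= M ->
   `|g (x + t *: d + (2^-1 * t ^+ 2) *: w) - (g x + t *: 'd g x d
     + (2^-1 * t ^+ 2) *: ('d g x w + 'd (fun y => 'd g y d) x d))| <= eps * t ^+ 2.
Proof.
move=> C2g eps0.
pose P (j : 'I_m) (t : R) := 0 < t -> forall w, `|w| <= M ->
  `|g (x + t *: d + (2^-1 * t ^+ 2) *: w) 0 j - g x 0 j - t * 'd g x d 0 j
     - 2^-1 * t ^+ 2 * ('d g x w 0 j + 'd (fun y => 'd g y d) x d 0 j)| <= eps * t ^+ 2.
have : \forall t \near (0 : R), forall j, P j t.
  apply: (@filter_forall R 'I_m P (nbhs (0 : R)) _) => j.
  have [dg C1g] := C2g.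
  have E1 w : 'd g x w 0 j = 'd (fun y => dot (g y) (delta_mx 0 j)) x w.
    by rewrite -dot_delta -diff_dotr.
  have E2 : 'd (fun y => 'd g y d) x d 0 j =
      'd (fun y => 'd (fun z => dot (g z) (delta_mx 0 j)) y d) x d.
    rewrite -dot_delta -diff_dotr; last exact: (C1g _).1.
    by congr ('d _ x d); apply/funext => y; rewrite diff_dotr.
  have [dl dl0 hdl] := second_order_expansion M (C2_dotr (delta_mx 0 j) C2g) eps0 E1 E2.
  have := @near_dist_lt R R 0 dl dl0; apply: filterS => t; rewrite subr0 => tdl t0 w wM.
  by have := hdl t w t0 (le_lt_trans (ler_norm _) tdl) wM; rewrite !dot_delta.
move=> /near_distP[dl dl0 hdl]; exists dl => // t w t0 tdl wM.
have := hdl t; rewrite subr0 gtr0_norm// => /(_ tdl) ht.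
apply: norm_le_coord => [|j]; first by rewrite mulr_ge0 ?sqr_ge0// ltW.
rewrite second_order_remainder_coord; exact: ht.
Qed.

End C2Lemmas.

(** * Exact penalization *)
Section Penalty.
Context {R : realType} {n m : nat}.
Implicit Types (x d e w : 'rV[R]_n) (u v y z r : 'rV[R]_m) (S : set 'rV[R]_m).

(** The distance to a set is penalized in the Euclidean norm: residuals at closest
    points are normals for it, but not for the sup norm. *)
Definition enorm r : R := Num.sqrt (dot r r).

Lemma enorm_ge0 r : 0 <= enorm r. Proof. exact: sqrtr_ge0. Qed.

Lemma sqr_enorm r : enorm r ^+ 2 = dot r r.
Proof. by rewrite sqr_sqrtr// dot_ge0. Qed.

Lemma norm_le_enorm r : `|r| <= enorm r.
Proof. by apply: norm_le_dot; rewrite ?enorm_ge0// sqr_enorm. Qed.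

Lemma enorm_le_norm r : enorm r <= m.+1%:R * `|r|.
Proof.
rewrite -(@ler_pXn2r _ 2%N) ?nnegrE ?enorm_ge0 ?mulr_ge0// sqr_enorm.
apply: (le_trans (dot_le _ _)); rewrite exprMn -!expr2 ler_wpM2r ?sqr_ge0//.
by rewrite -natrX ler_nat expnS expn1 (leq_trans (leqnSn m))// leq_pmulr.
Qed.

Lemma continuous_enorm : continuous enorm.
Proof.
move=> r; apply: (@continuous_comp _ _ _ (fun r => dot r r) Num.sqrt).
  by apply: (@cvg_dot _ _ _ (nbhs r) _ id id r r); exact: cvg_id.
exact: sqrt_continuous.
Qed.

(** First-order optimality of [x] for the residual plus [c] times a norm. Squared
    residuals are compared along the ray of direction [e]; [gap] is the amount by
    which the claim would fail. *)
Lemma penalty_stationary (g : 'rV[R]_n -> 'rV[R]_m) x z (c : R) e :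
  0 <= c -> differentiable g x ->
  (\forall y \near x, enorm (g x - z) <= enorm (g y - z) + c * `|y - x|) ->
  - (c * enorm (g x - z) * `|e|) <= dot (g x - z) ('d g x e).
Proof.
move=> c0 dg /near_distP[rho rho0 hrho].
set r := g x - z; set v := 'd g x e.
rewrite leNgt; apply/negP; set a := dot r v => hlt.
pose gap : R := - (c * enorm r * `|e|) - a.
have gap0 : 0 < gap by rewrite subr_gt0.
pose K : R := m%:R.
have K0 : 0 <= K by [].
(* [eps] bounds the error of the first-order expansion of [g], and [L] the
   second-order term of the squared residual. *)
pose eps : R := Num.min 1 (gap / (2 * (K * `|r| + 1))).
have eps0 : 0 < eps.
  by rewrite lt_min ltr01 divr_gt0// mulr_gt0// ltr_wpDl// mulr_ge0.
have [dl dl0 hdl] := derive_bound e dg eps0.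
pose L : R := K * (`|v| + 1) ^+ 2 + 1.
have L0 : 0 < L by rewrite ltr_wpDl// mulr_ge0// sqr_ge0.
pose t : R := Num.min (dl / 2) (Num.min (rho / (2 * (`|e| + 1))) (gap / (L * 2))).
have e1 : 0 < `|e| + 1 by rewrite ltr_wpDl.
have t0 : 0 < t by rewrite !lt_min !divr_gt0// mulr_gt0.
have tdl : t < dl.
  by rewrite (@le_lt_trans _ _ (dl / 2)) ?ge_min ?lexx// ltr_pdivrMr// ltr_pMr// ltr1n.
have trho : t * `|e| < rho.
  have : t <= rho / (2 * (`|e| + 1)) by rewrite !ge_min lexx orbT.
  rewrite ler_pdivlMr ?mulr_gt0//; have := normr_ge0 e; nra.
have tgap : t * (L * 2) <= gap by rewrite -ler_pdivlMr ?mulr_gt0// !ge_min lexx !orbT.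
clearbody t.
have hr1 := hdl t t0 tdl.
have : enorm r <= enorm (g (x + t *: e) - z) + c * (t * `|e|).
  have := hrho (x + t *: e).
  have -> : x + t *: e - x = t *: e by rewrite addrC addKr.
  by rewrite normrZ gtr0_norm//; apply.
set r1 := g (x + t *: e) - z => hE.
pose eta := t^-1 *: (g (x + t *: e) - g x - t *: v).
have etae : `|eta| <= eps.
  by rewrite normrZ gtr0_norm ?invr_gt0// ler_pdivrMl// mulrC.
have r1E : r1 = r + t *: (v + eta).
  rewrite /eta scalerDr scalerA divff ?gt_eqF// scale1r.
  by apply/matrixP => i j; rewrite !mxE; ring.
have hE2 : dot r r - 2 * c * (t * `|e|) * enorm r <= dot r1 r1.
  rewrite -!sqr_enorm; have := enorm_ge0 r; have := enorm_ge0 r1.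
  have : 0 <= c * (t * `|e|) by rewrite mulr_ge0// mulr_ge0// ltW.
  have -> : 2 * c * (t * `|e|) = 2 * (c * (t * `|e|)) by rewrite -mulrA.
  move: hE; move: (enorm r) (enorm r1) (c * _) => X Y Z h1 h2 h3 h4.
  have [ZX|XZ] := leP Z X; last by nra.
  have : 0 <= (Y - (X - Z)) * (Y + (X - Z)) by apply: mulr_ge0; lra.
  nra.
have : dot r1 r1 <= dot r r + 2 * t * a + t * gap + t * (t * L).
  rewrite r1E dotDD dotZr dotZl dotZr [dot r (v + eta)]dotDr -/a.
  have h1 : 2 * dot r eta <= gap.
    apply: (@le_trans _ _ (2 * (K * (`|r| * eps)))).
      by rewrite ler_pM2l// (le_trans (dot_le _ _))// ler_wpM2l// ler_wpM2l.
    have : eps <= gap / (2 * (K * `|r| + 1)) by rewrite ge_min lexx orbT.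
    rewrite ler_pdivlMr; last by rewrite mulr_gt0// ltr_wpDl// mulr_ge0.
    lra.
  have h2 : dot (v + eta) (v + eta) <= L.
    apply: (le_trans (dot_le _ _)); rewrite /L ler_wpDr// ler_wpM2l// -expr2.
    rewrite ler_pXn2r ?nnegrE ?addr_ge0// (le_trans (ler_normD _ _))// lerD2l.
    by rewrite (le_trans etae)// ge_min lexx.
  have h3 := ler_wpM2l (ltW (mulr_gt0 t0 t0)) h2.
  have h4 := ler_wpM2l (ltW t0) h1.
  lra.
have h5 := ler_wpM2l (ltW t0) tgap.
have : 0 < t * gap by rewrite mulr_gt0.
rewrite /gap in h5 *; lra.
Qed.

(** The minimization runs over pairs of a point and an element of [S], so that a
    minimizer carries a closest point. The unit balls only provide compactness:
    in the application the minimizer lies in their interior. *)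
Lemma penalty_minimizer S (g : 'rV[R]_n -> 'rV[R]_m) x y x0 z0 (c : R) :
  closed S -> continuous g -> S z0 -> `|x0 - x| <= 1 -> `|z0 - y| <= 1 ->
  exists x1 z1, [/\ S z1, `|x1 - x| <= 1, `|z1 - y| <= 1 &
    forall x2 z2, S z2 -> `|x2 - x| <= 1 -> `|z2 - y| <= 1 ->
      enorm (g x1 - z1) + c * `|x1 - x0| <= enorm (g x2 - z2) + c * `|x2 - x0|].
Proof.
move=> clS cg Sz0 x0x z0y.
pose A : set 'rV[R]_n := [set x2 | `|x2 - x| <= 1].
pose B : set 'rV[R]_m := S `&` [set z2 | `|z2 - y| <= 1].
have cball k (p : 'rV[R]_k) : closed [set q : 'rV[R]_k | `|q - p| <= 1].
  apply: (preimage_closed (f := fun q : 'rV[R]_k => `|q - p|) (D := [set r | r <= 1])) => [a _|].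
    apply: (@continuous_comp _ _ _ (fun q : 'rV[R]_k => q - p) (@Num.norm R _)); last exact: norm_continuous.
    by apply: (@continuousB _ _ _ id (cst p)); [exact: cvg_id|exact: cst_continuous].
  exact: closed_le.
have bball k (p : 'rV[R]_k) : bounded_set [set q : 'rV[R]_k | `|q - p| <= 1].
  exists (`|p| + 1); split => [|M hM q /= qp]; first exact: num_real.
  by rewrite (le_trans _ (ltW hM))// -(subrK p q) addrC (le_trans (ler_normD _ _))// lerD2l.
have cA : compact A by apply: bounded_closed_compact; [exact: bball|exact: cball].
have cB : compact B.
  by rewrite /B setIC; apply: compact_closedI => //; apply: bounded_closed_compact; [exact: bball|exact: cball].
pose Psi (p : 'rV[R]_n * 'rV[R]_m) := enorm (g p.1 - p.2) + c * `|p.1 - x0|.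
have cPsi : continuous Psi.
  move=> [p1 p2]; apply: cvgD.
    apply: (@continuous_comp _ _ _ (fun p : 'rV[R]_n * 'rV[R]_m => g p.1 - p.2) enorm); last exact: continuous_enorm.
    apply: (@continuousB _ _ _ (fun p : 'rV[R]_n * 'rV[R]_m => g p.1) snd); last exact: cvg_snd.
    apply: (@continuous_comp _ _ _ fst g); [exact: cvg_fst|exact: cg].
  apply: cvgM; first exact: cvg_cst.
  apply: (@continuous_comp _ _ _ (fun p : 'rV[R]_n * 'rV[R]_m => p.1 - x0) (@Num.norm R _)); last exact: norm_continuous.
  apply: (@continuousB _ _ _ fst (cst x0)); [exact: cvg_fst|exact: cst_continuous].
have AB0 : A `*` B !=set0 by exists (x0, z0); split => //; split.
have [[x1 z1]] := compact_EVT_min AB0 (compact_setX cA cB) (continuous_subspaceT cPsi).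
rewrite inE => -[/= Ax1 [Sz1 Bz1]] hmin; exists x1, z1; split => // x2 z2 Sz2 Ax2 Bz2.
by apply: (hmin (x2, z2)); rewrite inE; split => //; split.
Qed.

End Penalty.

(** * Second-order tangents of the feasible set *)
Lemma second_order_rescale (R : realType) (k : nat) (y p a a' b : 'rV[R]_k) (s : R) :
  s != 0 -> s^-1 *: (y - p) - (a + b) =
    s^-1 *: (y - (p + s *: (a' + b))) + (a' - a).
Proof. by move=> s0; apply/matrixP => i j; rewrite !mxE; field. Qed.

Section Subregularity.
Context {R : realType} {n m : nat}.
Implicit Types (x d e w : 'rV[R]_n) (g : 'rV[R]_n -> 'rV[R]_m) (S : set 'rV[R]_m).

Lemma norm_mulmx_bound (k l : nat) (M : 'M[R]_(k, l)) :
  exists2 C : R, 0 <= C & forall u : 'rV[R]_k, `|u *m M| <= C * `|u|.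
Proof.
exists (\sum_i `|row i M|) => [|u]; first exact: sumr_ge0.
rewrite mulmx_sum_row mulr_suml (le_trans (ler_norm_sum _ _ _))//.
by apply: ler_sum => i _; rewrite normrZ mulrC ler_wpM2l// coord_le_norm.
Qed.

Lemma continuous_mulmx (k l : nat) (M : 'M[R]_(k, l)) :
  continuous (fun u : 'rV[R]_k => u *m M).
Proof.
have -> : (fun u : 'rV[R]_k => u *m M) = (fun u => \sum_i u 0 i *: row i M).
  by apply/funext => u; exact: mulmx_sum_row.
move=> u; apply: (@cvg_sumr R _ _ _ (nbhs u) _) => i; apply: cvgZr_tmp; exact: coord_continuous.
Qed.

Lemma diff_jacobian g x e : differentiable g x -> 'd g x e = e *m 'J g x.
Proof. by move=> dg; rewrite -deriveEjacobian// deriveE. Qed.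

(** Second derivative of [g] at [x] evaluated at (d, d). *)
Definition diff2 g x d := 'd (fun y => 'd g y d) x d.

Lemma second_order_expansion_jacobian g x d (M eps : R) : C2 g -> 0 < eps ->
  exists2 dl : R, 0 < dl & forall (t : R) w, 0 < t -> t < dl -> `|w| <= M ->
   `|g (x + t *: d + (2^-1 * t ^+ 2) *: w) - (g x + t *: (d *m 'J g x)
     + (2^-1 * t ^+ 2) *: (w *m 'J g x + diff2 g x d))| <= eps * t ^+ 2.
Proof.
move=> C2g eps0; have [dl dl0 hdl] := second_order_expansion_vec x d M C2g eps0.
exists dl => // t w t0 tdl wM.
rewrite -(diff_jacobian d (C2g.1 x)) -(diff_jacobian w (C2g.1 x)); exact: hdl.
Qed.

(** A second-order arc in the feasible set is mapped by [g] to a second-order arc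
    in [S], whose second-order term is read off the Taylor expansion. *)
Lemma second_order_tangent_image g S x d w : C2 g ->
  second_order_tangent_set (feasible_set g S) x d w ->
  second_order_tangent_set S (g x) (d *m 'J g x) (w *m 'J g x + diff2 g x d).
Proof.
move=> C2g /second_order_tangentP Tw; apply/second_order_tangentP => e e0.
set A := 'J g x; set b := diff2 g x d.
have [C C0 hC] := norm_mulmx_bound A.
have C1 : 0 < C + 1 by rewrite ltr_wpDl.
have e4 : 0 < e / 8 by rewrite divr_gt0.
have [dl dl0 hdl] := @second_order_expansion_jacobian g x d (`|w| + 1) (e / 8) C2g e4.
pose e1 : R := Num.min (Num.min 1 dl) (Num.min e (e / (2 * (C + 1)))).
have e10 : 0 < e1 by rewrite !lt_min ltr01 dl0 e0 divr_gt0// mulr_gt0.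
have [t [w' [t0 te w'w Fw']]] := Tw _ e10.
move: te w'w; rewrite !lt_min => /andP[/andP[_ tdl] /andP[te _]] /andP[/andP[w1 _] /andP[_ we]].
have [s sE] : exists s : R, s = 2^-1 * t ^+ 2 by eexists.
have s0 : 0 < s by rewrite sE mulr_gt0 ?invr_gt0 ?exprn_gt0.
have w'M : `|w'| <= `|w| + 1.
  by rewrite -(subrK w w') addrC (le_trans (ler_normD _ _))// lerD2l ltW.
have := hdl t w' t0 tdl w'M; rewrite -/A -/b -sE => h.
move: Fw'; rewrite /feasible_set/= -sE => Fw'.
set y := g _ in h Fw'.
exists t, (s^-1 *: (y - (g x + t *: (d *m A)))); split => //; last first.
  rewrite -sE scalerA divff ?gt_eqF// scale1r.
  by rewrite addrCA subrr addr0.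
rewrite (second_order_rescale _ _ _ (w' *m A)) ?gt_eqF//.
rewrite -mulmxBl (le_lt_trans (ler_normD _ _))// normrZ gtr0_norm ?invr_gt0//.
have h1 : s^-1 * `|y - (g x + t *: (d *m A) + s *: (w' *m A + b))| <= e / 4.
  by rewrite ler_pdivrMl// (le_trans h)// sE; lra.
have h2 : C * `|w' - w| <= e / 2.
  move: we; rewrite ltr_pdivlMr ?mulr_gt0// => we.
  have := normr_ge0 (w' - w); lra.
have := hC (w' - w); lra.
Qed.

(** Robinson's condition with the limiting cone in place of its closed convex
    hull; it suffices for directional metric subregularity. *)
Definition dir_limiting_cq g S x d := forall l, l *m ('J g x)^T = 0 ->
  dir_normal_cone S (g x) (d *m 'J g x) l -> l = 0.

(** Unit normals at points approaching y along the direction v accumulate at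
    unit vectors of the directional normal cone, which the constraint
    qualification keeps away from the kernel of the adjoint: compactness of the
    sphere makes this quantitative. *)
Lemma adjoint_lower_bound (A : 'M[R]_(n, m)) S (y v : 'rV[R]_m) :
  (forall l, l *m A^T = 0 -> dir_normal_cone S y v l -> l = 0) ->
  exists2 kap : R, 0 < kap & forall (t : R) z r, 0 < t -> t < kap ->
    `|z - (y + t *: v)| < kap * t -> regular_normal_cone S z r -> r != 0 ->
    kap <= dot ((`|r|^-1 *: r) *m A^T) ((`|r|^-1 *: r) *m A^T).
Proof.
move=> CQ.
apply: (@dir_normal_compactness _ _ S y v (fun p => dot (p *m A^T) (p *m A^T))).
  by move=> p; have cp := @continuous_mulmx _ _ A^T p; exact: (cvg_dot cp cp).
move=> p Np p1; apply: dot_gt0; apply/eqP => pA; have p0 := CQ p pA Np.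
by move: p1; rewrite p0 normr0 => /esym/eqP; rewrite oner_eq0.
Qed.

(** Moving along minus the adjoint image of the unit normal p decreases the
    residual at the rate of the squared norm of this image, up to the error of
    order [c] in the Jacobian, whereas stationarity of the penalized distance
    only allows a rate of order [c]. *)
Lemma no_penalty_stationary (A : 'M[R]_(n, m)) (c CT : R) (r D1 : 'rV[R]_m) :
  0 < c -> 0 <= CT -> (forall u : 'rV[R]_m, `|u *m A^T| <= CT * `|u|) -> r != 0 ->
  let p := `|r|^-1 *: r in let e := - (p *m A^T) in
  - (c * enorm r * `|e|) <= dot r D1 -> `|D1 - e *m A| <= c * `|e| ->
  dot (p *m A^T) (p *m A^T) < 2 * m.+1%:R * c * (CT + 1).
Proof.
move=> c0 CT0 hCT r0 p e' hst hD1.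
pose mm : R := m.+1%:R; have mm0 : 0 < mm by rewrite ltr0n.
have rn0 : 0 < `|r| by rewrite normr_gt0.
have p1 : `|p| = 1 by rewrite normrZ gtr0_norm ?invr_gt0// mulVf ?gt_eqF.
have e'CT : `|e'| <= CT by have := hCT p; rewrite p1 mulr1 normrN.
have h1 : - (c * mm * CT) <= dot p D1.
  rewrite /p dotZl ler_pdivlMl//; apply: le_trans hst.
  have := ler_wpM2l (enorm_ge0 r) e'CT; have := ler_wpM2r CT0 (enorm_le_norm r).
  rewrite -/mm => k1 k2; have := ler_wpM2l (ltW c0) (le_trans k2 k1); lra.
have h2 : dot p D1 <= - dot (p *m A^T) (p *m A^T) + mm * (c * CT).
  have -> : D1 = e' *m A + (D1 - e' *m A) by rewrite addrC subrK.
  rewrite dotDr dotC dot_mulmx /e' dotNl lerD2l.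
  rewrite (le_trans (dot_le _ _))// p1 mul1r.
  apply: (@le_trans _ _ (m%:R * (c * CT))).
    by rewrite ler_wpM2l// (le_trans hD1)// ler_wpM2l// ltW.
  by apply: ler_wpM2r; [exact: mulr_ge0 (ltW c0) CT0|rewrite /mm ler_nat].
have : 0 < mm * c := mulr_gt0 mm0 c0.
rewrite -/mm; lra.
Qed.

(** The point [x0] on the arc defined by [w] has a residual of order ep * t^2
    with respect to [z0]. Comparing with the pair ([x0], [z0]) puts the penalty
    minimizer ([x1], [z1]) within e * t^2 / 2 of [x0], so that [x1] lies on an arc
    defined by some [w1] close to [w]. If [x1] were infeasible, its residual would
    be a regular normal at [z1], which contradicts [no_penalty_stationary]. *)
Lemma second_order_tangent_preimage g S x d w : C2 g -> closed S ->
  dir_limiting_cq g S x d ->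
  second_order_tangent_set S (g x) (d *m 'J g x) (w *m 'J g x + diff2 g x d) ->
  second_order_tangent_set (feasible_set g S) x d w.
Proof.
move=> C2g clS CQ /second_order_tangentP Tu; apply/second_order_tangentP => e e0.
set A := 'J g x in CQ Tu *; set b := diff2 g x d in Tu; set v := d *m A in CQ Tu *.
set u := w *m A + b in Tu.
have [CT CT0 hCT] := norm_mulmx_bound A^T.
have [CA CA0 hCA] := norm_mulmx_bound A.
have [kap kap0 hkap] := adjoint_lower_bound CQ.
(* With this penalty parameter the bound in [no_penalty_stationary] is [kap]. *)
pose c : R := kap / ((2 * m.+1%:R) * (CT + 1)).
have c0 : 0 < c by rewrite divr_gt0// mulr_gt0// ?mulr_gt0// ltr_wpDl.
have C1g : C1 g by split=> [y|z]; [exact: C2g.1|move=> y; apply: differentiable_continuous; exact: (C2g.2 z).1].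
have [rho rho0 hrho] := near_distP (C1_near x C1g c0).
pose mm : R := m.+1%:R.
have mm0 : 0 < mm by rewrite ltr0n.
pose M : R := `|w| + e.
have M0 : 0 < M by rewrite ltr_wpDl.
have [ep [ep0 ep1 epc]] : exists ep : R, [/\ 0 < ep, ep <= 1 & ep * (8 * mm) <= c * e].
  exists (Num.min 1 (c * e / (8 * mm))); split.
  - by rewrite lt_min ltr01 divr_gt0// mulr_gt0.
  - by rewrite ge_min lexx.
  - by rewrite -ler_pdivlMr ?mulr_gt0// ge_min lexx orbT.
have [dl dl0 hdl] := @second_order_expansion_jacobian g x d M ep C2g ep0.
rewrite -/A -/b -/v in hdl.
pose CC : R := 2 * mm + (CA * M + `|b|) + 1.
have CAM0 : 0 <= CA * M by exact: mulr_ge0 CA0 (ltW M0).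
have CC0 : 0 < CC by have := normr_ge0 b; rewrite /CC; lra.
pose KK : R := CC + `|v| + `|u| + 1.
have KK0 : 0 < KK by have := normr_ge0 u; have := normr_ge0 v; rewrite /KK; lra.
pose dM : R := `|d| + M.
have dM0 : 0 < dM by rewrite ltr_wpDl.
pose e1 : R := Num.min (Num.min (Num.min e ep) (Num.min dl (Num.min 1 kap)))
  (Num.min (Num.min (kap / CC) KK^-1) (Num.min 1 rho / dM)).
have e10 : 0 < e1.
  by rewrite !lt_min e0 ep0 dl0 kap0 ltr01 invr_gt0 KK0 !divr_gt0// lt_min ltr01.
have [t [u' [t0 te u'u Sz0]]] := Tu _ e10.
have {u'u} u'u : `|u' - u| < ep by move: u'u; rewrite !lt_min -!andbA => /and3P[].
move: te; rewrite !lt_min -!andbA => /and5P[te _ tdl t1 /and4P[tk tCC tKK tdM]].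
have {}tCC : t * CC < kap by rewrite -ltr_pdivlMr.
have {}tKK : t * KK < 1 by rewrite -ltr_pdivlMr// div1r.
have {}tdM : t * dM < Num.min 1 rho by rewrite -ltr_pdivlMr.
clear e10; have [s sE] : exists s : R, s = 2^-1 * t ^+ 2 by eexists.
have s0 : 0 < s by rewrite sE mulr_gt0 ?invr_gt0 ?exprn_gt0.
have st : s <= t by rewrite sE expr2; nra.
rewrite -sE in Sz0 *; set z0 := _ + _ + _ in Sz0.
pose x0 := x + t *: d + s *: w.
have wM : `|w| <= M by rewrite lerDl ltW.
have near_x w' : `|w'| <= M -> `|x + t *: d + s *: w' - x| < Num.min 1 rho.
  move=> w'M; have -> : x + t *: d + s *: w' - x = t *: d + s *: w'.
    by apply/matrixP => i j; rewrite !mxE; ring.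
  rewrite (le_lt_trans (ler_normD _ _))// !normrZ (gtr0_norm t0) (gtr0_norm s0).
  apply: le_lt_trans tdM; rewrite /dM mulrDr lerD2l.
  by rewrite ler_pM// ltW.
have gap0 : `|g x0 - z0| <= 2 * ep * t ^+ 2.
  have := hdl t w t0 tdl wM; rewrite -sE -/x0 => h.
  have -> : g x0 - z0 = (g x0 - (g x + t *: v + s *: u)) - s *: (u' - u).
    by apply/matrixP => i j; rewrite /z0 !mxE; ring.
  rewrite (le_trans (ler_normB _ _))// normrZ (gtr0_norm s0).
  have := ler_wpM2l (ltW s0) (ltW u'u).
  have : s * ep <= ep * t ^+ 2 by rewrite sE; have := sqr_ge0 t; nra.
  rewrite -/u in h; lra.
have z0x : `|z0 - g x| <= 1.
  have -> : z0 - g x = t *: v + s *: u'.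
    by apply/matrixP => i j; rewrite /z0 !mxE; ring.
  rewrite (le_trans (ler_normD _ _))// !normrZ (gtr0_norm t0) (gtr0_norm s0).
  have u'1 : `|u'| <= `|u| + 1.
    rewrite -(subrK u u') addrC (le_trans (ler_normD _ _))// lerD2l.
    exact: le_trans (ltW u'u) ep1.
  have : s * `|u'| <= t * (`|u| + 1) by rewrite ler_pM// ltW.
  have : 0 < t * CC by rewrite mulr_gt0.
  move: tKK; rewrite /KK; lra.
have x0x : `|x0 - x| <= 1.
  by have := near_x w wM; rewrite lt_min => /andP[/ltW].
have cg : continuous g by move=> y; apply: differentiable_continuous; exact: C2g.1.
have [x1 [z1 [Sz1 x1x z1x hmin]]] := penalty_minimizer c clS cg Sz0 x0x z0x.
set r := g x1 - z1 in hmin.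
have small : enorm r + c * `|x1 - x0| <= mm * (2 * ep * t ^+ 2).
  have := hmin x0 z0 Sz0 x0x z0x; rewrite subrr normr0 mulr0 addr0 => /le_trans; apply.
  by rewrite (le_trans (enorm_le_norm _))// ler_wpM2l// ltW.
have r_small : `|r| <= 2 * mm * t ^+ 2.
  have h1 : 0 <= c * `|x1 - x0| by rewrite mulr_ge0// ltW.
  have h2 : ep * (mm * t ^+ 2) <= mm * t ^+ 2.
    by rewrite ler_piMl// mulr_ge0 ?sqr_ge0// ltW.
  have := norm_le_enorm r; lra.
pose w1 := s^-1 *: (x1 - x - t *: d).
have x1E : x1 = x + t *: d + s *: w1.
  rewrite /w1 scalerA divff ?gt_eqF// scale1r.
  by apply/matrixP => i j; rewrite !mxE; ring.
have w1w : `|w1 - w| < e.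
  have -> : w1 - w = s^-1 *: (x1 - x0).
    rewrite /x0 [in RHS]x1E opprD addrACA subrr add0r -scalerBr scalerA mulVf ?gt_eqF//.
    by rewrite scale1r.
  rewrite normrZ gtr0_norm ?invr_gt0// ltr_pdivrMl//.
  have h1 := enorm_ge0 r.
  have h2 := ler_wpM2r (sqr_ge0 t) epc.
  have : c * `|x1 - x0| < c * (s * e).
    have : 0 < c * (t ^+ 2 * e) := mulr_gt0 c0 (mulr_gt0 (exprn_gt0 2 t0) e0).
    rewrite sE; lra.
  by rewrite ltr_pM2l.
have w1M : `|w1| <= M.
  by rewrite -(subrK w w1) addrC (le_trans (ler_normD _ _))// lerD2l ltW.
exists t, w1; split => //; rewrite -sE -x1E /feasible_set/=.
have [r0|r0] := eqVneq r 0.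
  by move/eqP: r0; rewrite subr_eq0 => /eqP ->.
exfalso.
(* The residual [r] is nonzero: the minimizer lies in the interior of both balls,
   and [z1] leaves [g x] nearly in the direction [v]. *)
have {x1x} [x1x x1rho] : `|x1 - x| < 1 /\ `|x1 - x| < rho.
  by have := near_x w1 w1M; rewrite -x1E lt_min => /andP[].
have z1pos : `|z1 - (g x + t *: v)| <= CC * t ^+ 2.
  have := hdl t w1 t0 tdl w1M; rewrite -sE -x1E => h.
  have -> : z1 - (g x + t *: v) =
     - r + (g x1 - (g x + t *: v + s *: (w1 *m A + b))) + s *: (w1 *m A + b).
    by rewrite /r; move: (w1 *m A) => Z; apply/matrixP => i j; rewrite !mxE; ring.
  rewrite (le_trans (ler_normD _ _))// normrZ (gtr0_norm s0).
  have h1 : `|w1 *m A + b| <= CA * M + `|b|.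
    rewrite (le_trans (ler_normD _ _))// lerD2r (le_trans (hCA _))//.
    by rewrite ler_wpM2l.
  have h2 := ler_wpM2l (ltW s0) h1.
  have h3 : s * (CA * M + `|b|) <= (CA * M + `|b|) * t ^+ 2.
    rewrite sE mulrC ler_wpM2l ?addr_ge0 ?mulr_ge0 ?(ltW M0)//.
    by rewrite ler_piMl ?sqr_ge0// invf_le1// ler1n.
  have h4 := ler_normD (- r) (g x1 - (g x + t *: v + s *: (w1 *m A + b))).
  rewrite normrN in h4.
  have h5 : ep * t ^+ 2 <= t ^+ 2 by rewrite ler_piMl ?sqr_ge0.
  rewrite /CC; lra.
have {z1x} z1x : `|z1 - g x| < 1.
  have -> : z1 - g x = (z1 - (g x + t *: v)) + t *: v.
    by apply/matrixP => i j; rewrite !mxE; ring.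
  rewrite (le_lt_trans (ler_normD _ _))// normrZ (gtr0_norm t0).
  have h1 : CC * t ^+ 2 <= t * CC.
    by rewrite mulrC ler_wpM2r ?(ltW CC0)// expr2 ler_piMl ?ltW.
  have h2 : 0 <= t * `|u| by rewrite mulr_ge0// ltW.
  move: tKK; rewrite /KK; lra.
have z1near : `|z1 - (g x + t *: v)| < kap * t.
  rewrite (le_lt_trans z1pos)// expr2 mulrA ltr_pM2r//.
  by rewrite mulrC.
have Nr : regular_normal_cone S z1 r.
  apply: projection_normal => //.
  have r1 : 0 < 1 - `|z1 - g x| by rewrite subr_gt0.
  have := @near_dist_lt R _ z1 _ r1; apply: filterS => z zz1 Sz.
  have zx : `|z - g x| <= 1.
    rewrite -(subrK z1 z) -addrA (le_trans (ler_normD _ _))//.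
    lra.
  have := hmin x1 z Sz (ltW x1x) zx; rewrite lerD2r -/r => h.
  by rewrite -!sqr_enorm ler_pXn2r ?nnegrE ?enorm_ge0.
have kapq := hkap t z1 r t0 tk z1near Nr r0.
pose e' := - ((`|r|^-1 *: r) *m A^T).
have [D1 hst hD1] : exists2 D1, - (c * enorm r * `|e'|) <= dot r D1 &
    `|D1 - e' *m A| <= c * `|e'|.
  exists ('d g x1 e'); last by rewrite -(diff_jacobian e' (C2g.1 x)); exact: hrho.
  apply: penalty_stationary => //; [exact: ltW|exact: C2g.1|].
  have r1 : 0 < 1 - `|x1 - x| by rewrite subr_gt0.
  have := @near_dist_lt R _ x1 _ r1; apply: filterS => y yx1.
  have yx : `|y - x| <= 1.
    rewrite -(subrK x1 y) -addrA (le_trans (ler_normD _ _))//.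
    lra.
  have := hmin y z1 Sz1 yx (ltW z1x); rewrite -/r.
  have h1 : `|y - x0| <= `|y - x1| + `|x1 - x0|.
    by rewrite -{1}(subrK x1 y) -addrA ler_normD.
  have := ler_wpM2l (ltW c0) h1; lra.
have := no_penalty_stationary c0 CT0 hCT r0 hst hD1.
have -> : 2 * m.+1%:R * c * (CT + 1) = kap.
  have -> : 2 * m.+1%:R * c * (CT + 1) = c * (2 * m.+1%:R * (CT + 1)) by ring.
  by rewrite /c divfK// gt_eqF// mulr_gt0// ?mulr_gt0// ltr_wpDl.
by rewrite ltNge kapq.
Qed.

End Subregularity.

(** * Multipliers by conic duality *)
Section LagrangianDerivatives.
Context {R : realType} {n m : nat}.
Implicit Types (f : 'rV[R]_n -> R) (g : 'rV[R]_n -> 'rV[R]_m) (x d w : 'rV[R]_n) (l : 'rV[R]_m).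

Lemma dot_inj (k : nat) (u v : 'rV[R]_k) : (forall w : 'rV[R]_k, dot u w = dot v w) -> u = v.
Proof. by move=> uv; apply/matrixP => i j; rewrite !ord1 -!dot_delta. Qed.

Lemma diff_lagrangian f g l x w : C2 f -> C2 g ->
  'd (lagrangian f g l) x w = 'd f x w + dot ('d g x w) l.
Proof.
move=> [df _] [dg _]; rewrite -diff_dotr//.
by apply: (@diffD_app _ _ _ f (fun y => dot (g y) l)) => //; exact: differentiable_dotr.
Qed.

Lemma C2_lagrangian f g l : C2 f -> C2 g -> C2 (lagrangian f g l).
Proof. by move=> C2f C2g; exact: (C2D C2f (C2_dotr l C2g)). Qed.

Lemma grad_lagrangian f g l x : C2 f -> C2 g ->
  grad (lagrangian f g l) x = grad f x + l *m ('J g x)^T.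
Proof.
move=> C2f C2g; apply: dot_inj => w.
have [dL _] := C2_lagrangian l C2f C2g.
apply: (eq_trans (dot_grad w (dL x))); apply: (eq_trans (diff_lagrangian l x w C2f C2g)).
rewrite dotDl (dotC (l *m _)) -dot_mulmx; congr (_ + dot _ l).
  exact: esym (dot_grad w (C2f.1 x)).
exact: diff_jacobian w (C2g.1 x).
Qed.

Lemma qform_hess_lagrangian f g l x d : C2 f -> C2 g ->
  qform (hess (lagrangian f g l) x) d = qform (hess f x) d + dot (diff2 g x d) l.
Proof.
move=> C2f C2g.
have E : (fun y => 'd (lagrangian f g l) y d) = (fun y => 'd f y d + dot ('d g y d) l).
  by apply/funext => y; exact: diff_lagrangian.
apply: (eq_trans (qform_hess x d (C2_lagrangian l C2f C2g))); rewrite E.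
have d2f := (C2f.2 d).1 x; have d2g := (C2g.2 d).1 x.
apply: (eq_trans (@diffD_app _ _ _ (fun y => 'd f y d) (fun y => dot ('d g y d) l) x d d2f
  (differentiable_dotr l d2g))).
congr (_ + _); first exact: esym (qform_hess x d C2f).
exact: diff_dotr.
Qed.

End LagrangianDerivatives.

Section Duality.
Context {R : realType} {n m : nat}.
Variables (A : 'M[R]_(n, m)) (a : 'rV[R]_n) (b : 'rV[R]_m) (al : R).
Variables (N C : set 'rV[R]_m).

Lemma affine_slope_ge0 (p q : R) : (forall t, 0 < t -> 0 <= p + t * q) -> 0 <= q.
Proof.
move=> h; rewrite leNgt; apply/negP => q0.
have t0 : 0 < (`|p| + 1) / - q by rewrite divr_gt0 ?oppr_gt0// ltr_wpDl.
have := h _ t0; have -> : (`|p| + 1) / - q * q = - (`|p| + 1).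
  by field; rewrite lt_eqF.
have := ler_norm p; lra.
Qed.

Lemma affine_value_ge0 (p q : R) : (forall t, 0 < t -> 0 <= p + t * q) -> 0 <= p.
Proof.
move=> h; rewrite leNgt; apply/negP => p0.
have q1 : 0 < `|q| + 1 by rewrite ltr_wpDl.
have t0 : 0 < - p / (2 * (`|q| + 1)) by rewrite divr_gt0 ?oppr_gt0// mulr_gt0.
have := h _ t0; set t := _ / _ in t0 *.
have : t * (2 * (`|q| + 1)) = - p by rewrite divfK// gt_eqF// mulr_gt0.
have := ler_wpM2l (ltW t0) (ler_norm q); lra.
Qed.

Lemma dot_rV1 (s : R) (u : 'rV[R]_1) : dot u (const_mx s) = u 0 0 * s.
Proof. by rewrite /dot big_ord1 mxE. Qed.

(** Separation of the origin from the pairs made of w A + b - u - k and a value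
    strictly above <a, w> + al. The parameters w, k and the slack s are then
    sent to infinity to obtain the stationarity equation, the polarity of the
    multiplier and the sign of the weight mu, and s is sent to 0 for the last
    inequality. *)
Lemma conic_duality : N 0 -> (forall t v, 0 < t -> N v -> N (t *: v)) ->
  (forall l, l *m A^T = 0 -> closure (convex_hull N) l -> l = 0) ->
  C !=set0 -> convex_set C ->
  (forall w u k, C u -> polar N k -> w *m A + b = u + k -> 0 <= dot a w + al) ->
  exists l, [/\ closure (convex_hull N) l, a + l *m A^T = 0 &
    forall u, C u -> dot l u <= al + dot b l].
Proof.
move=> N0 NZ CQ [u0 Cu0] /convex_setP cC hpos.
have KZ t k : 0 < t -> polar N k -> polar N (t *: k).
  by move=> t0 Kk v Nv; rewrite dotZr pmulr_rle0//; exact: Kk.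
have K0 : polar N 0 by move=> v _; rewrite dot0r.
pose pt w u k (s : R) : 'rV[R]_(m + 1) :=
  row_mx (w *m A + b - u - k) (const_mx (dot a w + al + s)).
pose M : set 'rV[R]_(m + 1) :=
  [set z | exists w u k s, [/\ C u, polar N k, 0 < s & z = pt w u k s]].
have cM : convex_set M.
  apply/convex_setP => _ _ t t0 t1 [w1 [u1 [k1 [s1 [Cu1 Kk1 s10 ->]]]]]
    [w2 [u2 [k2 [s2 [Cu2 Kk2 s20 ->]]]]].
  exists (t *: w1 + (1 - t) *: w2), (t *: u1 + (1 - t) *: u2),
    (t *: k1 + (1 - t) *: k2), (t * s1 + (1 - t) * s2); split.
  - exact: cC.
  - move=> v Nv; rewrite dotDr !dotZr.
    have := Kk1 _ Nv; have := Kk2 _ Nv; have : 0 <= 1 - t by rewrite subr_ge0.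
    nra.
  - have [ss|ss] := leP s1 s2; nra.
  rewrite /pt !scale_row_mx add_row_mx; congr row_mx.
    rewrite mulmxDl -!scalemxAl; move: (w1 *m A) (w2 *m A) => W1 W2.
    by apply/matrixP => i j; rewrite !mxE; ring.
  rewrite dotDr !dotZr; apply/matrixP => i j; rewrite !mxE; ring.
have M0 : ~ M 0.
  move=> [w [u [k [s [Cu Kk s0 /esym]]]]]; rewrite -row_mx0 => /eq_row_mx[e1 e2].
  have e3 : w *m A + b = u + k.
    by move/eqP: e1; rewrite -addrA -opprD subr_eq0 => /eqP.
  have := hpos w u k Cu Kk e3.
  by move/matrixP/(_ 0 0): e2; rewrite !mxE; lra.
have [|p p0 hp] := @weak_separation _ _ M (pt 0 u0 0 1) cM _ M0.
  by exists 0, u0, 0, 1.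
pose l := lsubmx p; pose mu := rsubmx p 0 0.
have {hp} hp w u k s : C u -> polar N k -> 0 < s ->
    0 <= dot l (w *m A + b - u - k) + mu * (dot a w + al + s).
  move=> Cu Kk s0; have := hp (pt w u k s); rewrite -[p]hsubmxK dot_row_mx dot_rV1.
  by apply; exists w, u, k, s.
have mu0 : 0 <= mu.
  apply: (@affine_slope_ge0 (dot l (b - u0) + mu * al)) => t t0.
  by have := hp 0 u0 0 t Cu0 K0 t0; rewrite mul0mx add0r subr0 dot0r; lra.
have lK k : polar N k -> dot k l <= 0.
  move=> Kk; rewrite -oppr_ge0.
  apply: (@affine_slope_ge0 (dot l (b - u0) + mu * (al + 1))) => t t0.
  have := hp 0 u0 (t *: k) 1 Cu0 (KZ _ _ t0 Kk) ltr01.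
  by rewrite mul0mx add0r dot0r (dotBr (b - u0)) dotZr (dotC l k); lra.
have lcl : closure (convex_hull N) l by apply: polar_polar.
have slope w : 0 <= dot l (w *m A) + mu * dot a w.
  apply: (@affine_slope_ge0 (dot l (b - u0) + mu * (al + 1))) => t t0.
  have := hp (t *: w) u0 0 1 Cu0 K0 ltr01.
  rewrite subr0 -scalemxAl !dotBr dotDr !dotZr; lra.
have stat : mu *: a + l *m A^T = 0.
  apply: dot_inj => w; rewrite dot0l dotDl dotZl (dotC (l *m _)) -dot_mulmx (dotC _ l).
  have := slope w; have := slope (- w); rewrite mulNmx !dotNr; lra.
have mupos : 0 < mu.
  rewrite lt_neqAle mu0 andbT; apply/eqP => mu00; move: p0 => /eqP; apply.
  have l0 : l = 0 by apply: CQ => //; move: stat; rewrite -mu00 scale0r add0r.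
  rewrite -[p]hsubmxK -/l l0 -[rsubmx p]/(rsubmx p) (_ : rsubmx p = 0) ?row_mx0//.
  by apply/matrixP => i j; rewrite !ord1 -/mu -mu00 mxE.
exists (mu^-1 *: l); split.
- apply: polar_polar => // k Kk; rewrite dotZr pmulr_rle0 ?invr_gt0//; exact: lK.
- have := congr1 (fun z => mu^-1 *: z) stat.
  by rewrite scalerDr scalerA mulVf ?gt_eqF// scale1r scaler0 scalemxAl.
move=> u Cu; rewrite dotZl dotZr ler_pdivrMl// mulrDr mulVKf ?gt_eqF//.
rewrite -subr_ge0; apply: (@affine_value_ge0 _ mu) => t t0.
have := hp 0 u 0 t Cu K0 t0; rewrite mul0mx add0r subr0 dot0r dotBr (dotC b); lra.
Qed.

End Duality.

Lemma ge0_sub_support (R : realType) (n : nat) (C : set 'rV[R]_n) l (q : R) :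
  (0 <= q%:E - support_function C l)%E <-> (forall u, C u -> dot l u <= q).
Proof.
rewrite subre_ge0//; split => [h u Cu|h].
  by rewrite -lee_fin (le_trans _ h)//; apply: ereal_sup_ubound; exists u.
by apply: ge_ereal_sup => _ [u Cu <-]; rewrite lee_fin; exact: h.
Qed.

Theorem proposition8 (R : realType) (n m : nat)
    (f : 'rV[R]_n -> R) (g : 'rV[R]_n -> 'rV[R]_m) (Lambda : set 'rV[R]_m)
    (xbar d : 'rV[R]_n)
    (hf : C2 f) (hg : C2 g) (hLambda : closed Lambda)
    (hxbar : feasible_set g Lambda xbar)
    (hd : critical_cone f g Lambda xbar d)
    (hT2 : second_order_tangent_set Lambda (g xbar) (d *m 'J g xbar) !=set0)
    (hCQ : dir_robinson_cq g Lambda xbar d) :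
  let T2 := second_order_tangent_set Lambda (g xbar) (d *m 'J g xbar) in
  let st1 :=
    forall w, second_order_tangent_set (feasible_set g Lambda) xbar d w ->
      0 <= dot (grad f xbar) w + qform (hess f xbar) d in
  let st2 :=
    forall u, T2 u ->
      exists2 l, dir_clarke_multipliers f g Lambda xbar d l &
        0 <= qform (hess (lagrangian f g l) xbar) d - dot l u in
  let st3 :=
    forall C : set 'rV[R]_m, C !=set0 -> convex_set C -> C `<=` T2 ->
      exists2 l, dir_clarke_multipliers f g Lambda xbar d l &
        (0 <= (qform (hess (lagrangian f g l) xbar) d)%:E
              - support_function C l)%E in
  (st1 <-> st2) /\ (st2 <-> st3).

Proof.
move=> T2 st1 st2 st3.
have dg := hg.1 xbar.
set A := 'J g xbar in hCQ T2 st1 st2 st3 *.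
set N := dir_normal_cone Lambda (g xbar) (d *m A).
have NNc : N `<=` dir_clarke_normal_cone Lambda (g xbar) (d *m A).
  by apply: subset_trans (@subset_closure _ _); exact: sub_gen_smallest.
have N0 : N 0 by apply: dir_normal0; exact: hd.1.
have gradL l : grad (lagrangian f g l) xbar = grad f xbar + l *m A^T by exact: grad_lagrangian.
have hessL l : qform (hess (lagrangian f g l) xbar) d =
    qform (hess f xbar) d + dot (diff2 g xbar d) l by exact: qform_hess_lagrangian.
have st13 : st1 -> st3.
  move=> h1 C C0 cC CT2.
  have [||l [lN lstat lC]] := @conic_duality R n m A (grad f xbar) (diff2 g xbar d)
      (qform (hess f xbar) d) N C N0 _ hCQ C0 cC.
  - by move=> t v t0; exact: dir_normalZ.
  - move=> w u k Cu Kk E; apply: h1; apply: second_order_tangent_preimage => //.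
      by move=> l lA lN; apply: hCQ => //; exact: NNc.
    by rewrite -/A E; apply: second_order_tangent_polar => //; exact: CT2.
  - exists l; first by split; rewrite ?gradL.
    by rewrite hessL; apply/ge0_sub_support.
have st32 : st3 -> st2.
  move=> h3 u Tu; have [|||l lL] := h3 [set u].
  - by exists u.
  - by apply/convex_setP => _ _ t _ _ -> ->; rewrite -scalerDl addrC subrK scale1r.
  - by move=> _ ->.
  by move/ge0_sub_support/(_ u erefl) => lu; exists l => //; rewrite subr_ge0.
have st21 : st2 -> st1.
  move=> h2 w Fw; have [l [lstat lN] hl] := h2 _ (second_order_tangent_image hg Fw).
  rewrite hessL in hl.
  rewrite gradL in lstat.
  have := congr1 (dot w) lstat.
  rewrite dot0r dotDr -dot_mulmx => E.
  rewrite -/A dotDr in hl.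
  rewrite (dotC l (w *m _)) (dotC l (diff2 _ _ _)) in hl.
  rewrite (dotC (grad f xbar)).
  move: (dot w _) (dot (w *m A) l) E hl => p q E hl.
  lra.
by split; split=> // ?; [apply/st32/st13|apply/st13/st21].
Qed.
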